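(* Consider the closed-loop system formed by the power network dynamics, the generation and controllable demand dynamics, and the Privacy-Preserving scheme, as specified in the context, with state $(\eta,\psi,\omega,x,p^c)$. Suppose that the privacy-enhancing signals satisfy $n_{k,j}=n^d_{k,j}+n^f_{k,j}$ for all $k\in\mathcal N_j$, $j\in\mathcal N$, where (i) $n^d_{k,j}(t)=-\xi_{k,j}(t)\,\dot p^c_{k,j}(t)$, where the non-negative signal $\xi_{k,j}(t)$ satisfies $\dot\xi_{k,j}(t)<\hat\beta_{k,j}$ for all $t\ge 0$; (ii) $|n^f_{k,j}(t)|\le\beta_{k,j}|\omega_j(t)|$ for all $t\ge0$; and the positive constants $\beta_{k,j},\hat\beta_{k,j}$ satisfy, for all $k\in\mathcal N_j$, $j\in\mathcal N$, $$\begin{bmatrix}-h_{k,j}-D_j/|\mathcal N_j| & h_{k,j}+\beta_{k,j}/2\\ h_{k,j}+\beta_{k,j}/2 & -h_{k,j}+\hat\beta_{k,j}/2\end{bmatrix}\preceq0 .$$ Then the solutions of the system globally asymptotically converge to the set of its equilibria (that is, for every initial condition the solution converges to the set of equilibria as $t\to\infty$), where $\omega^*=\boldsymbol{0}_{|\mathcal N|}$ (every equilibrium has all frequency deviations equal to zero).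
   Context: Network. $(\mathcal N,\mathcal E)$ is a finite connected graph (buses and lines), with an arbitrary orientation of its edges, so that $(i,j)\in\mathcal E$ implies $(j,i)\notin\mathcal E$. For $j\in\mathcal N$, $\mathcal N^p_j=\{k:(k,j)\in\mathcal E\}$ and $\mathcal N^s_j=\{k:(j,k)\in\mathcal E\}$. At each bus $j$ there is a finite set $\mathcal N^G_j$ of generation units and a finite set $\mathcal N^L_j$ of controllable loads (disjoint), and $\mathcal N_j=\mathcal N^G_j\cup\mathcal N^L_j$ is the set of active units at bus $j$. Units are indexed by pairs $(k,j)$ with $k\in\mathcal N_j$, $j\in\mathcal N$; $\widetilde{\mathcal N}$ is the set of all active units in the network (the union over $j$ of the $\mathcal N_j$). Power network dynamics (real-valued, continuous time): $\dot\eta_{ij}=\omega_i-\omega_j$, $(i,j)\in\mathcal E$; $M_j\dot\omega_j=\sum_{k\in\mathcal N^G_j}p^M_{k,j}-\sum_{k\in\mathcal N^L_j}d^c_{k,j}-\sum_{k\in\mathcal N_j}p^L_{k,j}-D_j\omega_j-\sum_{i\in\mathcal N^s_j}p_{ji}+\sum_{i\in\mathcal N^p_j}p_{ij}$, $j\in\mathcal N$; $p_{ij}=B_{ij}\eta_{ij}$, $(i,j)\in\mathcal E$; with constants $B_{ij}>0$, $M_j>0$, $D_j>0$, and constant uncontrollable demands $p^L_{k,j}\in\mathbb R$. Generation and controllable demand dynamics: $\tau_{k,j}\dot x_{k,j}=-x_{k,j}+m_{k,j}(u_{k,j}-\omega_j)$ and $p^M_{k,j}=x_{k,j}+h_{k,j}(u_{k,j}-\omega_j)$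 for $k\in\mathcal N^G_j$, $j\in\mathcal N$; $d^c_{k,j}=-h_{k,j}(u_{k,j}-\omega_j)$ for $k\in\mathcal N^L_j$, $j\in\mathcal N$; with constants $\tau_{k,j},m_{k,j},h_{k,j}>0$. Prosumption vector: $\widetilde s\in\mathbb R^{|\widetilde{\mathcal N}|}$ has entries $\widetilde s_{k,j}=-p^M_{k,j}+p^L_{k,j}$ for $k\in\mathcal N^G_j$ and $\widetilde s_{k,j}=d^c_{k,j}+p^L_{k,j}$ for $k\in\mathcal N^L_j$. Privacy-Preserving scheme. $(\widetilde{\mathcal N},\widetilde{\mathcal E})$ is a connected (communication) graph with incidence matrix $H\in\mathbb R^{|\widetilde{\mathcal N}|\times|\widetilde{\mathcal E}|}$, where $H_{ie}=+1$ if $i$ is the positive end of edge $e$, $-1$ if $i$ is the negative end of $e$, and $0$ otherwise. The scheme is $\widetilde\Gamma\dot\psi=H^Tp^c$, $\quad\Gamma\dot p^c=\widetilde s-H\psi+n$, $\quad u=p^c$, where $\psi\in\mathbb R^{|\widetilde{\mathcal E}|}$, $p^c=[p^c_{k,j}]\in\mathbb R^{|\widetilde{\mathcal N}|}$, $u=[u_{k,j}]$, $\widetilde\Gamma,\Gamma$ are diagonal matrices with positive diagonal entries, and $n=[n_{k,j}]$ is a locally Lipschitz privacy-enhancing signal. The signals $\xi_{k,j}$ and $n^f_{k,j}$ are (deterministic) time-dependent signals. An equilibrium is a point $(\eta^*,\psi^*,\omega^*,x^*,p^{c,*})$ at which all time derivatives of the closed-loop system are zero. $A\preceq0$ means that $A$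 is negative semi-definite. *)

(* Defs.v *)
From mathcomp Require Import all_boot all_order all_algebra.
From mathcomp Require Import all_classical all_reals all_analysis.
Set Implicit Arguments.
Unset Strict Implicit.
Unset Printing Implicit Defensive.
Import Order.TTheory GRing.Theory Num.Theory numFieldNormedType.Exports.
Local Open Scope classical_set_scope.
Local Open Scope ring_scope.

(* A simple graph is given by its set of ordered edges: each edge occurs with
   exactly one (arbitrary) orientation, which also excludes self-loops. *)
Definition oriented (T : finType) (E : {set T * T}) : Prop :=
  forall i j : T, (i, j) \in E -> (j, i) \notin E.

Definition connected_graph (T : finType) (E : {set T * T}) : Prop :=
  forall i j : T,
    connect (fun a b : T => ((a, b) \in E) || ((b, a) \in E)) i j.

Definition edge (T : finType) (E : {set T * T}) : finType := {e : T * T | e \in E}.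

Definition incidence (R : realType) (T : finType) (E : {set T * T})
    (i : T) (e : edge E) : R :=
  if i == (val e).1 then 1 else if i == (val e).2 then -1 else 0.

Definition neg_semidefinite (R : realType) (n : nat) (A : 'M[R]_n) : Prop :=
  forall v : 'cV[R]_n, (v^T *m A *m v) ord0 ord0 <= 0.

(* The active units of the network are the elements of the disjoint sum
   [gen + load].  A unit carries the bus it is attached to, so the sets
   of generation units and of loads at bus j are the fibres over j of [gen_bus]
   and [load_bus], and a pair index (k, j) is a unit k with [unit_bus k = j]. *)
Record network (R : realType) := Network {
  bus : finType;
  gen : finType;
  load : finType;
  gen_bus : gen -> bus;
  load_bus : load -> bus;
  lines : {set bus * bus};
  links : {set (gen + load) * (gen + load)};
  suscept : edge lines -> R;              (* B *)
  inertia : bus -> R;                     (* M *)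
  damping : bus -> R;                     (* D *)
  demand : gen + load -> R;               (* p^L *)
  tau : gen -> R;
  droop : gen -> R;                       (* m *)
  gain : gen + load -> R;                 (* h *)
  psi_rate : edge links -> R;             (* diagonal of \tilde\Gamma *)
  pc_rate : gen + load -> R;              (* diagonal of \Gamma *)
  lines_oriented : oriented lines;
  lines_connected : connected_graph lines;
  links_oriented : oriented links;
  links_connected : connected_graph links;
  suscept_gt0 : forall e, 0 < suscept e;
  inertia_gt0 : forall j, 0 < inertia j;
  damping_gt0 : forall j, 0 < damping j;
  tau_gt0 : forall g, 0 < tau g;
  droop_gt0 : forall g, 0 < droop g;
  gain_gt0 : forall k, 0 < gain k;
  psi_rate_gt0 : forall e, 0 < psi_rate e;
  pc_rate_gt0 : forall k, 0 < pc_rate k }.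

Section ClosedLoop.
Context {R : realType}.
Variable P : network R.

Definition line : finType := edge (lines P).
Definition link : finType := edge (links P).
Definition unit_ : finType := (gen P + load P)%type.

Definition unit_bus (k : unit_) : bus P :=
  match k with inl g => gen_bus g | inr l => load_bus l end.

Definition units_at (j : bus P) : {set unit_} := [set k | unit_bus k == j].

Record state := State {
  eta : line -> R;
  psi : link -> R;
  omega : bus P -> R;
  xg : gen P -> R;
  pc : unit_ -> R }.

Definition state0 : state :=
  State (fun=> 0) (fun=> 0) (fun=> 0) (fun=> 0) (fun=> 0).

Section Outputs.
Variables (z : state) (u : unit_ -> R).

Definition flow (e : line) : R := suscept e * eta z e.

Definition mech_power (g : gen P) : R :=
  xg z g + gain (inl g : unit_) * (u (inl g) - omega z (gen_bus g)).

Definition ctrl_demand (l : load P) : R :=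
  - (gain (inr l : unit_) * (u (inr l) - omega z (load_bus l))).

Definition prosumption (k : unit_) : R :=
  match k with
  | inl g => - mech_power g + demand (inl g : unit_)
  | inr l => ctrl_demand l + demand (inr l : unit_)
  end.

End Outputs.

(* [dz] is the vector of time derivatives of the state [z], [n] the value of
   the privacy-enhancing signal, and the input is u = p^c. *)
Definition closed_loop (z dz : state) (n : unit_ -> R) : Prop :=
  let u := pc z in
  [/\ forall e : line, eta dz e = omega z (val e).1 - omega z (val e).2,
      forall j : bus P,
        inertia j * omega dz j =
          \sum_(g : gen P | gen_bus g == j) mech_power z u g
          - \sum_(l : load P | load_bus l == j) ctrl_demand z u l
          - \sum_(k in units_at j) demand k
          - damping j * omega z j
          - \sum_(e : line | (val e).1 == j) flow z e
          + \sum_(e : line | (val e).2 == j) flow z e,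
      forall g : gen P,
        tau g * xg dz g = - xg z g + droop g * (u (inl g) - omega z (gen_bus g)),
      forall e : link,
        psi_rate e * psi dz e = \sum_(k : unit_) incidence R k e * pc z k
    & forall k : unit_,
        pc_rate k * pc dz k =
          prosumption z u k - \sum_(e : link) incidence R k e * psi z e + n k].

(* Trajectories are functions on all of [R] of which only the restriction to
   [0, +oo) matters: one that is right-differentiable at 0 can be
   extended affinely to negative times, so asking for a two-sided derivative at
   0 is no restriction. *)
Definition differentiable_at (z : R -> state) (t : R) : Prop :=
  [/\ forall e, derivable (fun s => eta (z s) e) t 1,
      forall e, derivable (fun s => psi (z s) e) t 1,
      forall j, derivable (fun s => omega (z s) j) t 1,
      forall g, derivable (fun s => xg (z s) g) t 1
    & forall k, derivable (fun s => pc (z s) k) t 1].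

Definition velocity (z : R -> state) (t : R) : state :=
  State (fun e => derive1 (fun s => eta (z s) e) t)
        (fun e => derive1 (fun s => psi (z s) e) t)
        (fun j => derive1 (fun s => omega (z s) j) t)
        (fun g => derive1 (fun s => xg (z s) g) t)
        (fun k => derive1 (fun s => pc (z s) k) t).

Definition is_solution (z : R -> state) (n : unit_ -> R -> R) : Prop :=
  forall t : R, 0 <= t ->
    differentiable_at z t /\ closed_loop (z t) (velocity z t) (n ^~ t).

Section Privacy.
Variables beta betahat : unit_ -> R.

Definition privacy_lmi (k : unit_) : 'M[R]_(1 + 1) :=
  let h := gain k in
  let D := damping (unit_bus k) in
  block_mx (- h - D / #|units_at (unit_bus k)|%:R)%:M (h + beta k / 2)%:M
           (h + beta k / 2)%:M                        (- h + betahat k / 2)%:M.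

(* Instantaneous constraints on the values of n, n^d, n^f and xi when the state
   is [z] and its time derivative is [dz]. *)
Definition privacy_values (z dz : state) (n nd nf xi : unit_ -> R) : Prop :=
  forall k : unit_,
    [/\ n k = nd k + nf k,
        nd k = - xi k * pc dz k,
        0 <= xi k
      & `|nf k| <= beta k * `|omega z (unit_bus k)|].

Definition privacy_signals (z : R -> state) (n nd nf xi : unit_ -> R -> R) : Prop :=
  [/\ forall k : unit_, [locally [lipschitz n k t | t in [set t : R | 0 <= t]]],
      forall t : R, 0 <= t ->
        privacy_values (z t) (velocity z t) (n ^~ t) (nd ^~ t) (nf ^~ t) (xi ^~ t)
    & forall (k : unit_) (t : R), 0 <= t ->
        derivable (xi k) t 1 /\ derive1 (xi k) t < betahat k].

(* The closed loop is time-varying through xi and n^f only.  An equilibrium is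
   a state that stays put (zero derivatives) for some values of the signals
   compatible with the constraints above at that state. *)
Definition equilibrium (z : state) : Prop :=
  exists n nd nf xi : unit_ -> R,
    privacy_values z state0 n nd nf xi /\ closed_loop z state0 n.

End Privacy.

Definition state_close (eps : R) (z z' : state) : Prop :=
  [/\ forall e, `|eta z e - eta z' e| < eps,
      forall e, `|psi z e - psi z' e| < eps,
      forall j, `|omega z j - omega z' j| < eps,
      forall g, `|xg z g - xg z' g| < eps
    & forall k, `|pc z k - pc z' k| < eps].

Definition converges_to_set (z : R -> state) (S : set state) : Prop :=
  forall eps : R, 0 < eps ->
    \forall t \near +oo, exists2 z' : state, S z' & state_close eps (z t) z'.

End ClosedLoop.

(* Main.v *)
(* Shift the closed loop to an equilibrium with the same conserved components
   (those of [eta] and [psi] outside the gradients) as the initial state, and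
   combine
   - the stored energy, in which the physical part (line and inertia energy) is
     weighted by [1 + d] and the [p^c] part by [Gamma + xi(t)];
   - a small multiple of the cross term [p^c . H psi + M omega . A B eta], where
     [A] is the incidence matrix of the lines.
   The weight makes the dissipation strict in [x], [omega] and [p^c] even when
   the matrix inequality is degenerate; the cross term adds dissipation in
   [A B eta] and, divided by [Gamma + xi], in [H psi]. As [xi] grows at most
   linearly, the sum [W] satisfies [W' <= - c W / (1 + t)], which still forces
   [W] to tend to 0, since [ln (1 + t)] is unbounded. *)

Require Import Defs.
From mathcomp Require Import all_boot all_order all_algebra.
From mathcomp Require Import all_classical all_reals all_analysis.
From mathcomp Require Import ring lra.
Set Implicit Arguments.
Unset Strict Implicit.
Unset Printing Implicit Defensive.
Import Order.TTheory GRing.Theory Num.Theory numFieldNormedType.Exports.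
Local Open Scope classical_set_scope.
Local Open Scope ring_scope.

(** LaSalle's principle is out of reach: [xi] and [nf] make the closed loop depend on time, and [xi]
    may be unbounded, so the energy has no upper bound uniform in time. Its derivative also ignores
    [eta] and [psi]. Hence an explicit strict inequality with constants.

    The weight [Gamma + xi] comes from moving [n^d] to the left of the [p^c] equation.
    Differentiating it yields [dxi / 2 * pc ^+ 2], which is exactly what the entry [betahat / 2] of
    the matrix inequality absorbs.

    The growth of [xi] costs a factor [1 + t] in two places: the energy of [p^c] may be that much
    larger than its dissipation, and the dissipation in [H psi] that much smaller than its energy.
    These are different components, so the losses do not multiply and the rate stays of order
    [1 / (1 + t)], just short of being integrable.

    The cross term only sees the outflows [A B eta] and [H psi], which are blind to circulations.
    Fixing the conserved components leaves deviations that are gradients, and on a connected graph a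
    gradient is determined by its outflow. *)

Section HalfLineDerivative.
Context {R : realType}.

Lemma is_derive_fsum (I : finType) (A : pred I) (f : I -> R -> R) (df : I -> R)
    (t : R) : (forall i, is_derive t 1 (f i) (df i)) ->
  is_derive t 1 (fun s => \sum_(i | A i) f i s) (\sum_(i | A i) df i).
Proof.
move=> h; have -> : (fun s => \sum_(i | A i) f i s) = \sum_(i | A i) f i.
  by apply/funext => s; rewrite fct_sumE.
by elim/big_ind2 : _ => // [|] *; [exact: is_derive_cst|exact: is_deriveD].
Qed.

Lemma is_derive_mul (f g : R -> R) (df dg t : R) :
  is_derive t 1 f df -> is_derive t 1 g dg ->
  is_derive t 1 (fun s => f s * g s) (df * g t + f t * dg).
Proof.
move=> hf hg; have := is_deriveM hf hg.
by rewrite /GRing.scale/= addrC (mulrC (g t)).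
Qed.

Lemma is_derive_mull (c : R) (f : R -> R) (df t : R) :
  is_derive t 1 f df -> is_derive t 1 (fun s => c * f s) (c * df).
Proof. by move=> hf; have := is_deriveZ c hf. Qed.

Lemma is_derive_sqr (f : R -> R) (df t : R) :
  is_derive t 1 f df -> is_derive t 1 (fun s => f s ^+ 2) (2 * (f t * df)).
Proof.
move=> hf; have h := is_derive_mul hf hf.
by apply: (is_derive_eq h); ring.
Qed.

Lemma nonincreasing_from (f df : R -> R) :
  (forall t : R, 0 <= t -> is_derive t 1 f (df t)) ->
  (forall t : R, 0 <= t -> df t <= 0) ->
  forall s t : R, 0 <= s -> s <= t -> f t <= f s.
Proof.
move=> hf hle; apply: ler0_derive1_nincry.
- by move=> x; rewrite in_itv/= andbT => /ltW /hf h; exact: ex_derive.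
- move=> x; rewrite in_itv/= andbT => /ltW x0.
  by rewrite derive1E; have -> := @derive_val _ _ _ _ _ _ _ (hf x x0); exact: hle.
- apply: derivable_within_continuous => x; rewrite in_itv/= andbT => /hf h.
  exact: ex_derive.
Qed.

Lemma constant_from (f : R -> R) :
  (forall t : R, 0 <= t -> is_derive t 1 f 0) -> forall t : R, 0 <= t -> f t = f 0.
Proof.
move=> hf t t0; apply/eqP; rewrite eq_le; apply/andP; split.
  exact: (@nonincreasing_from f (fun=> 0)).
rewrite -lerN2; apply: (@nonincreasing_from (fun s => - f s) (fun=> 0)) => // s s0.
by rewrite -oppr0; apply: is_deriveN; exact: hf.
Qed.

(* Integrating the differential inequality while [W >= eps] costs
   [c eps ln (1 + t)], which is unbounded. *)
Lemma log_decay (W dW : R -> R) (c : R) : 0 < c ->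
  (forall t : R, 0 <= t -> is_derive t 1 W (dW t)) ->
  (forall t : R, 0 <= t -> 0 <= W t) ->
  (forall t : R, 0 <= t -> dW t <= - (c / (1 + t) * W t)) ->
  forall eps : R, 0 < eps -> exists2 T : R, 0 <= T & forall t, T <= t -> W t < eps.
Proof.
move=> c0 hW W0 hle eps eps0.
have dW_le0 (t : R) : 0 <= t -> dW t <= 0.
  move=> t0; apply: (le_trans (hle t t0)); rewrite oppr_le0.
  by rewrite mulr_ge0 ?W0// divr_ge0 ?addr_ge0// ltW.
have [[T T0 WT]|nex] := pselect (exists2 T : R, 0 <= T & W T < eps).
  exists T => // t Tt; apply: le_lt_trans WT.
  exact: (@nonincreasing_from W dW).
have Wge (t : R) : 0 <= t -> eps <= W t.
  by move=> t0; rewrite leNgt; apply/negP => lt; apply: nex; exists t.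
pose f t := W t + c * eps * ln (1 + t).
have hf (t : R) : 0 <= t -> is_derive t 1 f (dW t + c * eps * (1 + t)^-1).
  move=> t0; apply: is_deriveD; first exact: hW.
  apply: is_derive_mull.
  have h : is_derive t 1 (fun s : R => 1 + s) (0 + 1) by apply: is_deriveD.
  have p : 0 < 1 + t by rewrite ltr_pwDl.
  have := is_derive1_comp (is_derive1_ln p) h.
  by rewrite add0r mulr1.
have fle (t : R) : 0 <= t -> f t <= f 0.
  move=> t0; apply: (nonincreasing_from hf) => // s s0.
  apply: (le_trans (lerD (hle s s0) (lexx _))).
  rewrite addrC subr_le0 mulrAC ler_pM2l ?Wge//.
  by rewrite divr_gt0// ltr_pwDl.
(* This [t] solves [c * eps * ln (1 + t) = f 0 + 1], so [f t <= f 0] would force [W t <= -1]. *)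
pose t := expR ((f 0 + 1) / (c * eps)) - 1.
have f00 : 0 <= f 0 by rewrite /f addr0 ln1 mulr0 addr0 W0.
have t0 : 0 <= t.
  rewrite subr_ge0; apply: (le_trans _ (expR_ge1Dx _)); rewrite lerDl.
  by apply: divr_ge0; [exact: addr_ge0|apply: ltW; exact: mulr_gt0].
have := fle t t0; rewrite {1}/f {2}/t addrCA subrr addr0 expRK mulrC divfK; last first.
  by rewrite mulf_neq0// gt_eqF.
rewrite -/(f 0) => h; exfalso.
have := W0 t t0; rewrite /t => h'; lra.
Qed.

End HalfLineDerivative.

(** * Graph Laplacians *)

Section Laplacian.
Context {R : realType} {T : finType} {E : {set T * T}}.
Hypothesis oriE : oriented E.

Lemma edge_neq (e : edge E) : (val e).1 != (val e).2.
Proof.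
case: e => -[i j] /= ij; apply/eqP => ijE; move: ij; rewrite ijE => jj.
by have := oriE jj; rewrite jj.
Qed.

Lemma sum_incidence (e : edge E) (th : T -> R) :
  \sum_i incidence R i e * th i = th (val e).1 - th (val e).2.
Proof.
have ne := edge_neq e.
rewrite (bigD1 (val e).1)//= (bigD1 (val e).2)/=; last by rewrite eq_sym.
rewrite big1 ?addr0; last first.
  by move=> i /andP[/negPf i1 /negPf i2]; rewrite /incidence i1 i2 mul0r.
by rewrite /incidence !eqxx eq_sym (negPf ne) mul1r mulN1r.
Qed.

Lemma sum_incidence1 (e : edge E) : \sum_i incidence R i e = 0.
Proof.
rewrite -[RHS](subrr 1) -(sum_incidence e (fun=> 1)).
by apply: eq_bigr => i _; rewrite mulr1.
Qed.

Hypothesis conE : connected_graph E.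

Lemma connected_constant (f : T -> R) :
  (forall e : edge E, f (val e).1 = f (val e).2) -> forall i j, f i = f j.
Proof.
move=> fe i j; have /connectP[p] := conE i j.
elim: p i => [|k p ih] i /=; first by move=> _ ->.
move=> /andP[/orP ik pth] /ih <-//.
by case: ik => ik; [have := fe (Sub (_, _) ik)|have := fe (Sub (_, _) ik)]; rewrite SubK.
Qed.

(** Fredholm alternative for the weighted Laplacian [L]: a vector killed by [L] has zero Dirichlet
    form, hence is constant on a connected graph, hence is orthogonal to the zero-sum [s]. Row-space
    membership then gives a solution because [L] is symmetric. *)
Lemma laplacian_solvable (b : edge E -> R) (s : T -> R) :
  (forall e, 0 < b e) -> \sum_k s k = 0 ->
  exists th : T -> R, forall k,
    \sum_e incidence R k e * (b e * \sum_i incidence R i e * th i) = s k.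
Proof.
move=> b0 s0.
have sumT (F : T -> R) : \sum_(i < #|T|) F (enum_val i) = \sum_i F i.
  by rewrite [RHS](reindex _ (onW_bij _ (enum_val_bij T))).
pose L : 'M[R]_#|T| := \matrix_(i, j)
  \sum_e incidence R (enum_val i) e * (b e * incidence R (enum_val j) e).
pose v : 'rV[R]_#|T| := \row_i s (enum_val i).
have /submxP[D vE] : (v <= L)%MS.
  rewrite submxE; apply/eqP/matrixP => x k; rewrite !mxE.
  (* The columns of [cokermx L] are the kernel vectors to test against; [u] is one of them, read as
     a function on the vertices. *)
  pose u i := cokermx L (enum_rank i) k.
  have Lu i : \sum_e incidence R i e * (b e * \sum_j incidence R j e * u j) = 0.
    have /matrixP/(_ (enum_rank i) k) := mulmx_coker L; rewrite mxE [RHS]mxE => Lk; rewrite -[RHS]Lk.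
    transitivity (\sum_(j < #|T|) \sum_e
        incidence R i e * (b e * (incidence R (enum_val j) e * u (enum_val j)))).
      rewrite [RHS]exchange_big/=; apply: eq_bigr => e _.
      by rewrite -sumT !mulr_sumr.
    apply: eq_bigr => j _; rewrite mxE enum_rankK mulr_suml. apply: eq_bigr => e _.
    by rewrite /u enum_valK !mulrA.
  have dirichlet : \sum_e b e * (\sum_j incidence R j e * u j) ^+ 2 = 0.
    transitivity (\sum_i u i *
        \sum_e incidence R i e * (b e * \sum_j incidence R j e * u j)); last first.
      by rewrite big1// => i _; rewrite Lu mulr0.
    under [RHS]eq_bigr do rewrite mulr_sumr.
    rewrite exchange_big/=; apply: eq_bigr => e _.
    by rewrite expr2 mulrCA mulr_suml; apply: eq_bigr => i _; rewrite -mulrA mulrCA.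
  have ue (e : edge E) : u (val e).1 = u (val e).2.
    apply/eqP; rewrite -subr_eq0 -sum_incidence -sqrf_eq0.
    have /psumr_eq0P/(_ dirichlet)/(_ e isT)/eqP : forall e : edge E, true ->
        0 <= b e * (\sum_j incidence R j e * u j) ^+ 2.
      by move=> e' _; rewrite mulr_ge0 ?sqr_ge0 ?ltW.
    by rewrite mulf_eq0 gt_eqF.
  have uc := connected_constant ue.
  (* As [u] is constant, any vertex can serve as reference; the column index [k] supplies one, so no
     separate nonemptiness argument arises. *)
  transitivity (\sum_(i < #|T|) s (enum_val i) * u (enum_val k)).
    apply: eq_bigr => i _; rewrite mxE (uc (enum_val k) (enum_val i)).
    by rewrite /u enum_valK.
  by rewrite -mulr_suml sumT s0 mul0r.
exists (fun i => D 0 (enum_rank i)) => k.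
have /matrixP/(_ 0 (enum_rank k)) := vE; rewrite mxE [RHS]mxE enum_rankK => ->.
transitivity (\sum_(j < #|T|) \sum_e
    incidence R k e * (b e * (incidence R (enum_val j) e * D 0 j))).
  rewrite exchange_big/=; apply: eq_bigr => e _.
  rewrite -sumT !mulr_sumr; apply: eq_bigr => j _.
  by rewrite enum_valK.
apply: eq_bigr => j _; rewrite mxE mulr_sumr; apply: eq_bigr => e _.
by rewrite enum_rankK; ring.
Qed.

End Laplacian.

(** * Strict dissipation per unit *)

Section QuadraticForms.
Context {R : realFieldType}.

Lemma quadratic_form_gt0 (P Q C : R) : 0 < P -> 0 < C -> Q ^+ 2 < P * C ->
  exists2 sg, 0 < sg & forall a b,
    sg * (a ^+ 2 + b ^+ 2) <= P * a ^+ 2 - 2 * Q * (a * b) + C * b ^+ 2.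
Proof.
move=> P0 C0 det0.
(* The determinant over the trace bounds the least eigenvalue from below. *)
pose sg := (P * C - Q ^+ 2) / (P + C).
have tr0 : 0 < P + C by lra.
have sgE : sg * (P + C) = P * C - Q ^+ 2 by rewrite /sg divfK// gt_eqF.
exists sg; first by rewrite divr_gt0// subr_gt0.
move=> a b; have Psg : 0 < P - sg.
  rewrite -(pmulr_lgt0 _ tr0) mulrBl sgE.
  have P2 : 0 < P ^+ 2 by rewrite exprn_gt0.
  have Q2 := sqr_ge0 Q; lra.
rewrite -subr_ge0 -(pmulr_rge0 _ Psg).
(* Completing the square leaves, in front of [b ^+ 2], the characteristic polynomial of the form at
   [sg]; the choice of [sg] reduces it to [sg ^+ 2]. *)
have -> : (P - sg) * (P * a ^+ 2 - 2 * Q * (a * b) + C * b ^+ 2 -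
    sg * (a ^+ 2 + b ^+ 2)) =
  ((P - sg) * a - Q * b) ^+ 2 + (P * C - Q ^+ 2 - sg * (P + C) + sg ^+ 2) * b ^+ 2.
  by ring.
rewrite sgE subrr add0r; apply: addr_ge0; first exact: sqr_ge0.
by apply: mulr_ge0; exact: sqr_ge0.
Qed.

(** At the vector [(B, A)], which maximises the form in its first coordinate, the form equals
    [A * (B ^+ 2 - A * C)]. *)
Lemma quadratic_form_det (A B C : R) : 0 < A ->
  (forall a b, - A * a ^+ 2 + 2 * B * (a * b) - C * b ^+ 2 <= 0) ->
  B ^+ 2 <= A * C.
Proof.
move=> A0 /(_ B A) h; rewrite -subr_le0 -(pmulr_rle0 _ A0).
by apply: le_trans h; rewrite le_eqVlt; apply/orP; left; apply/eqP; ring.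
Qed.

End QuadraticForms.

(** Makes thresholds found unit by unit uniform. Requiring [Q i d] for every smaller [d] is what
    lets the minimum work, and the default [1] covers an empty index type. *)
Lemma finite_lower_bound {R : realFieldType} (I : finType) (Q : I -> R -> Prop) :
  (forall i, exists2 e, 0 < e & forall d, 0 < d -> d <= e -> Q i d) ->
  exists2 e, 0 < e & forall i d, 0 < d -> d <= e -> Q i d.
Proof.
move=> h; have /boolp.choice[f hf] : forall i, exists e : R,
    0 < e /\ forall d, 0 < d -> d <= e -> Q i d.
  by move=> i; have [e e0 he] := h i; exists e.
exists (\big[Num.min/1]_i f i).
  by apply/bigmin_gtP; split=> // i _; have [] := hf i.
move=> i d d0 dle; have [_ hd] := hf i; apply: hd => //.
by apply: (le_trans dle); exact: bigmin_le.
Qed.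

Section Inequality.
Context {R : realType} {P : network R}.
Variables beta betahat : unit_ P -> R.
Hypothesis beta_gt0 : forall k, 0 < beta k.
Hypothesis betahat_gt0 : forall k, 0 < betahat k.
Hypothesis lmi : forall k, neg_semidefinite (privacy_lmi beta betahat k).

Definition damping_share (k : unit_ P) : R :=
  damping (unit_bus k) / #|units_at (unit_bus k)|%:R.

Lemma damping_share_gt0 k : 0 < damping_share k.
Proof.
rewrite divr_gt0 ?damping_gt0// ltr0n card_gt0; apply/set0Pn.
by exists k; rewrite inE.
Qed.

(** The matrix inequality is unfolded only here; everything later uses it through this
    determinant. *)
Lemma lmi_det k : (gain k + beta k / 2) ^+ 2 <=
  (gain k + damping_share k) * (gain k - betahat k / 2).
Proof.
have hg := gain_gt0 k; have hd := damping_share_gt0 k.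
apply: quadratic_form_det => [|a b]; first by rewrite addr_gt0.
have := lmi k (col_mx a%:M b%:M).
rewrite /privacy_lmi -/(damping_share k) tr_col_mx mul_row_block mul_row_col.
rewrite !tr_scalar_mx -!scalar_mxM -!raddfD/= -!scalar_mxM -!raddfD/= mxE eqxx mulr1n.
by apply: le_trans; rewrite le_eqVlt; apply/orP; left; apply/eqP; ring.
Qed.

Lemma gain_gt_betahat k : 0 < gain k - betahat k / 2.
Proof.
have h0 := gain_gt0 k; have b0 := beta_gt0 k; have d0 := damping_share_gt0 k.
have A0 : 0 < gain k + damping_share k by lra.
rewrite -(pmulr_rgt0 _ A0); apply: lt_le_trans (lmi_det k).
by rewrite exprn_gt0//; lra.
Qed.

(** Expanding the determinant inequality cancels [gain k ^+ 2], and the remaining terms in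
    [beta k ^+ 2] and [betahat k] make it strict. This is what prevents the noise from balancing the
    damping at an equilibrium. *)
Lemma beta_lt_damping_share k : beta k < damping_share k.
Proof.
have h0 := gain_gt0 k; have b0 := beta_gt0 k; have d0 := damping_share_gt0 k.
have bh0 := betahat_gt0 k; have det := lmi_det k.
rewrite -(ltr_pM2l h0).
have : 0 < (gain k + damping_share k) * (betahat k / 2) by rewrite mulr_gt0//; lra.
have : 0 < beta k ^+ 2 by rewrite exprn_gt0.
nra.
Qed.

(* Weighting the physical energy by [1 + d] turns the possibly degenerate
   matrix inequality into a strict one: the determinant grows by
   [d * beta * (h + beta / 2) / 2] to first order in [d]. *)
Lemma unit_dissipation (m : R) k : 0 < m ->
  exists2 e, 0 < e & forall d, 0 < d -> d <= e ->
  exists2 e', 0 < e' & forall s, 0 < s -> s <= e' ->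
  forall a b x nf dxi, `|nf| <= beta k * `|a| -> dxi <= betahat k ->
    d * (a * x) + (2 + d) * gain k * (a * b)
    - ((1 + d) * gain k + (1 + d - s) * damping_share k) * a ^+ 2
    - gain k * b ^+ 2 + b * nf + dxi / 2 * b ^+ 2 - x ^+ 2 / m
    <= - (s * (b ^+ 2 + x ^+ 2)).
Proof.
move=> m0; have h0 := gain_gt0 k; have b0 := beta_gt0 k.
have C0 := gain_gt_betahat k; have det := lmi_det k; have dn0 := damping_share_gt0 k.
set h := gain k in h0 C0 det *; set be := beta k in b0 det *.
set C := h - _ in C0 det *; set dn := damping_share k in det dn0 *.
(* [d ^+ 2 * K] bounds the second-order loss of the determinant: [C * m / 2] comes from splitting
   [d * (a * x)] by Young's inequality, which lowers [A], and [h ^+ 2 / 4] from [(d * h / 2) ^+ 2]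
   in [Q ^+ 2]. The first-order gain is [d * N]. *)
pose K := C * m / 2 + h ^+ 2 / 4.
have K0 : 0 < K by rewrite addr_gt0 ?divr_gt0 ?mulr_gt0 ?exprn_gt0.
pose N := (h + be / 2) * (be / 2).
have N0 : 0 < N by rewrite mulr_gt0//; lra.
exists (N / K / 2); first by rewrite !divr_gt0.
move=> d d0 dle.
pose A := (1 + d) * (h + dn) - m * d ^+ 2 / 2.
pose Q := h + be / 2 + d * h / 2.
have dK : d * K < N.
  by rewrite -ltr_pdivlMr//; have := divr_gt0 N0 K0; lra.
have AC : Q ^+ 2 < A * C.
  have h1 : (1 + d) * (h + be / 2) ^+ 2 <= (1 + d) * ((h + dn) * C).
    by rewrite ler_pM2l//; lra.
  have h2 : d * (d * K) < d * N by rewrite ltr_pM2l.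
  rewrite -subr_gt0; apply: (@lt_le_trans _ _ (d * N - d * (d * K))); first lra.
  by rewrite /A /Q /N /K; lra.
have A0 : 0 < A.
  by rewrite -(pmulr_lgt0 _ C0); apply: le_lt_trans AC; exact: sqr_ge0.
have [sg sg0 hsg] := quadratic_form_gt0 A0 C0 AC.
(* In order: the damping held back in front of [a ^+ 2], the dissipation wanted in [b], and the half
   of [x ^+ 2 / m] that Young's inequality leaves over. *)
exists (Num.min (sg / dn) (Num.min sg (1 / (2 * m)))).
  by rewrite !lt_min sg0 (divr_gt0 sg0 dn0) divr_gt0 ?mulr_gt0.
move=> s s0; rewrite !le_min => /and3P[]; rewrite ler_pdivlMr// => s3 s1 s2.
move=> a b x nf dxi hnf hdxi.
have := hsg `|a| `|b|; rewrite !real_normK ?num_real// => form.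
have bnf : b * nf <= be * (`|a| * `|b|).
  apply: (le_trans (ler_norm _)); rewrite normrM mulrC mulrA.
  by rewrite ler_wpM2r.
have ab : (2 + d) * h * (a * b) <= (2 + d) * h * (`|a| * `|b|).
  by apply: ler_wpM2l; [apply: mulr_ge0; lra|rewrite -normrM ler_norm].
have xi2 : dxi / 2 * b ^+ 2 <= betahat k / 2 * b ^+ 2.
  by rewrite ler_wpM2r ?sqr_ge0//; lra.
have xa : d * (a * x) <= x ^+ 2 / (2 * m) + m * d ^+ 2 / 2 * a ^+ 2.
  rewrite -subr_ge0.
  have -> : x ^+ 2 / (2 * m) + m * d ^+ 2 / 2 * a ^+ 2 - d * (a * x) =
    (x - m * d * a) ^+ 2 / (2 * m) by field; rewrite gt_eqF.
  by rewrite divr_ge0 ?sqr_ge0// mulr_ge0// ltW.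
have q1 : s * b ^+ 2 <= sg * b ^+ 2 by rewrite ler_wpM2r ?sqr_ge0.
have q3 : s * dn * a ^+ 2 <= sg * a ^+ 2 by rewrite ler_wpM2r ?sqr_ge0.
have q2 : s * x ^+ 2 <= 1 / (2 * m) * x ^+ 2 by rewrite ler_wpM2r ?sqr_ge0.
have xm : x ^+ 2 / m = x ^+ 2 / (2 * m) + 1 / (2 * m) * x ^+ 2.
  by field; rewrite gt_eqF.
by move: form; rewrite /A /Q /C => form; lra.
Qed.

End Inequality.

(** * The strict Lyapunov function *)

Section SquaredNorm.
Context {R : realFieldType}.

Definition sqn (I : finType) (v : I -> R) : R := \sum_i v i ^+ 2.

Lemma sqn_ge0 (I : finType) (v : I -> R) : 0 <= sqn v.
Proof. by apply: sumr_ge0 => i _; exact: sqr_ge0. Qed.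

Lemma sqr_le_sqn (I : finType) (v : I -> R) i : v i ^+ 2 <= sqn v.
Proof.
rewrite /sqn (bigD1 i)//= lerDl; apply: sumr_ge0 => j _; exact: sqr_ge0.
Qed.

Lemma sqnD (I : finType) (u v : I -> R) :
  sqn (fun i => u i + v i) <= 2 * sqn u + 2 * sqn v.
Proof.
rewrite /sqn !mulr_sumr -big_split/=; apply: ler_sum => i _.
by rewrite -subr_ge0 (_ : _ - _ = (u i - v i) ^+ 2) ?sqr_ge0//; ring.
Qed.

Lemma ler_norm_sum_mul (I : finType) (u v : I -> R) :
  `|\sum_i u i * v i| <= (sqn u + sqn v) / 2.
Proof.
apply: (le_trans (ler_norm_sum _ _ _)).
rewrite /sqn -big_split/= mulr_suml; apply: ler_sum => i _.
rewrite normrM -(@real_normK _ (u i)) ?num_real// -(@real_normK _ (v i)) ?num_real//.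
by have := sqr_ge0 (`|u i| - `|v i|); lra.
Qed.

Lemma weighted_sum_le (I : finType) (w : I -> R) :
  exists2 C, 0 < C & forall v : I -> R, (forall i, 0 <= v i) ->
    \sum_i w i * v i <= C * \sum_i v i.
Proof.
have S0 : 0 <= \sum_i `|w i| by exact: sumr_ge0.
exists (1 + \sum_i `|w i|); first by rewrite ltr_pwDl.
move=> v v0; rewrite mulr_sumr; apply: ler_sum => i _.
apply: ler_wpM2r => //; apply: (le_trans (ler_norm _)).
rewrite [X in 1 + X](bigD1 i)//= addrCA lerDl addr_ge0//.
exact: sumr_ge0.
Qed.

Lemma weighted_sum_ge (I : finType) (w : I -> R) : (forall i, 0 < w i) ->
  exists2 c, 0 < c & forall v : I -> R, (forall i, 0 <= v i) ->
    c * \sum_i v i <= \sum_i w i * v i.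
Proof.
move=> w0; exists (\big[Num.min/1]_i w i).
  by apply/bigmin_gtP; split.
move=> v v0; rewrite mulr_sumr; apply: ler_sum => i _.
by apply: ler_wpM2r => //; exact: bigmin_le.
Qed.

Lemma diagonal_bound (I : finType) (w : I -> R) :
  exists2 C, 0 < C & forall v : I -> R, sqn (fun i => w i * v i) <= C * sqn v.
Proof.
have [C C0 hC] := weighted_sum_le (fun i => w i ^+ 2).
exists C => // v; have /hC : forall i, 0 <= v i ^+ 2 by move=> i; exact: sqr_ge0.
by apply: le_trans; rewrite /sqn; apply: ler_sum => i _; rewrite exprMn.
Qed.

(** Cauchy-Schwarz row by row, with one plus the squared Frobenius norm of [G] as constant; the
    added one keeps it positive when [G] vanishes. *)
Lemma linear_image_bound (I J : finType) (G : I -> J -> R) :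
  exists2 C, 0 < C & forall (u : I -> R) (v : J -> R),
    (forall i, u i = \sum_j G i j * v j) -> sqn u <= C * sqn v.
Proof.
exists (1 + \sum_i \sum_j G i j ^+ 2).
  rewrite ltr_pwDl//; apply: sumr_ge0 => i _; apply: sumr_ge0 => j _; exact: sqr_ge0.
move=> u v uE; rewrite mulrDl mul1r.
suff h : sqn u <= (\sum_i \sum_j G i j ^+ 2) * sqn v.
  by apply: (le_trans h); rewrite lerDr sqn_ge0.
rewrite {1}/sqn mulr_suml; apply: ler_sum => i _; rewrite uE.
(* Lagrange's identity: this sum is twice the defect in the Cauchy-Schwarz inequality. *)
have : 0 <= \sum_j \sum_l (G i j * v l - G i l * v j) ^+ 2.
  by apply: sumr_ge0 => j _; apply: sumr_ge0 => l _; exact: sqr_ge0.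
have -> : \sum_j \sum_l (G i j * v l - G i l * v j) ^+ 2 =
    2 * ((\sum_j G i j ^+ 2) * sqn v - (\sum_j G i j * v j) ^+ 2).
  have sum2 (f g : J -> R) :
      \sum_j \sum_l f j * g l = (\sum_j f j) * (\sum_l g l).
    by rewrite mulr_suml; apply: eq_bigr => j _; rewrite mulr_sumr.
  transitivity (\sum_j \sum_l G i j ^+ 2 * v l ^+ 2
      + \sum_j \sum_l v j ^+ 2 * G i l ^+ 2
      - 2 * \sum_j \sum_l (G i j * v j) * (G i l * v l)).
    rewrite mulr_sumr -big_split -sumrB; apply: eq_bigr => j _ /=.
    rewrite mulr_sumr -big_split -sumrB; apply: eq_bigr => l _ /=; ring.
  by rewrite !sum2 /sqn; ring.
by rewrite pmulr_rge0// subr_ge0.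
Qed.

End SquaredNorm.

(** * Deviation from an equilibrium and dissipation of the energy *)

Section ErrorDynamics.
Context {R : realType} {P : network R}.

Definition bus_outflow (y : state P) (j : bus P) : R :=
  \sum_(e : line P) incidence R j e * (suscept e * eta y e).

Definition link_outflow (y : state P) (k : unit_ P) : R :=
  \sum_(e : link P) incidence R k e * psi y e.

(** Loads receive a zero internal state, and below the harmless divisor [1] as droop, so that one
    formula treats generators and loads alike. *)
Definition gen_state (y : state P) (k : unit_ P) : R :=
  match k with inl g => xg y g | inr _ => 0 end.

Definition droop_of (k : unit_ P) : R :=
  match k with inl g => droop g | inr _ => 1 end.

(** The deviation of the prosumption of [k]; the constant demand has dropped out. *)
Definition response (y : state P) (k : unit_ P) : R :=
  - gen_state y k - gain k * (pc y k - omega y (unit_bus k)).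

(* The dynamics of the deviation from an equilibrium; [n^d = - xi * dp^c/dt] has
   been moved to the left-hand side. *)
Definition error_dynamics (y dy : state P) (xi nf : unit_ P -> R) : Prop :=
  [/\ forall e : line P, eta dy e = \sum_j incidence R j e * omega y j,
      forall j : bus P, inertia j * omega dy j =
        - \sum_(k : unit_ P | unit_bus k == j) response y k
        - damping j * omega y j - bus_outflow y j,
      forall g : gen P, tau g * xg dy g =
        - xg y g + droop g * (pc y (inl g) - omega y (gen_bus g)),
      forall e : link P,
        psi_rate e * psi dy e = \sum_(k : unit_ P) incidence R k e * pc y k
    & forall k : unit_ P,
        (pc_rate k + xi k) * pc dy k = response y k - link_outflow y k + nf k].

Definition energy (d : R) (y : state P) (xi : unit_ P -> R) : R :=
  (1 + d) / 2 * (\sum_(e : line P) suscept e * eta y e ^+ 2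
                 + \sum_j inertia j * omega y j ^+ 2)
  + 2^-1 * (\sum_g tau g / droop g * xg y g ^+ 2
            + \sum_(e : link P) psi_rate e * psi y e ^+ 2
            + \sum_(k : unit_ P) (pc_rate k + xi k) * pc y k ^+ 2).

(** The formal derivative of [energy] in the direction [dy], [dxi]. Keeping it algebraic separates
    the estimates from the calculus, which enters only in [is_derive_energy]; [cross_rate] plays the
    same part for [cross]. *)
Definition energy_rate (d : R) (y dy : state P) (xi dxi : unit_ P -> R) : R :=
  (1 + d) * (\sum_(e : line P) suscept e * (eta y e * eta dy e)
             + \sum_j inertia j * (omega y j * omega dy j))
  + (\sum_g tau g / droop g * (xg y g * xg dy g)
     + \sum_(e : link P) psi_rate e * (psi y e * psi dy e)
     + \sum_(k : unit_ P) ((pc_rate k + xi k) * (pc y k * pc dy k)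
                           + dxi k / 2 * pc y k ^+ 2)).

Definition cross (y : state P) : R :=
  \sum_(k : unit_ P) pc y k * link_outflow y k
  + \sum_j inertia j * omega y j * bus_outflow y j.

Definition cross_rate (y dy : state P) : R :=
  \sum_(k : unit_ P) (pc dy k * link_outflow y k + pc y k * link_outflow dy k)
  + \sum_j (inertia j * omega dy j * bus_outflow y j
            + inertia j * omega y j * bus_outflow dy j).

Definition damped_sqn (y : state P) : R :=
  sqn (gen_state y) + sqn (omega y) + sqn (pc y).

Lemma sum_over_buses (w : bus P -> R) (f : unit_ P -> R) :
  \sum_j w j * \sum_(k : unit_ P | unit_bus k == j) f k =
  \sum_(k : unit_ P) w (unit_bus k) * f k.
Proof.
rewrite [RHS](partition_big (@unit_bus R P) predT)//=.
by apply: eq_bigr => j _; rewrite mulr_sumr; apply: eq_bigr => k /eqP ->.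
Qed.

(** The exchanges between [eta] and [omega] and between [psi] and [pc] are lossless and cancel. The
    weight [tau / droop] also cancels the coupling of [xg] with [pc], and that with [omega] up to
    the factor [d]. *)
Lemma energy_rateE d y dy xi dxi nf : error_dynamics y dy xi nf ->
  energy_rate d y dy xi dxi =
  \sum_(k : unit_ P) (d * (omega y (unit_bus k) * gen_state y k)
    + (2 + d) * gain k * (omega y (unit_bus k) * pc y k)
    - (1 + d) * gain k * omega y (unit_bus k) ^+ 2
    - gain k * pc y k ^+ 2 + pc y k * nf k + dxi k / 2 * pc y k ^+ 2
    - gen_state y k ^+ 2 / droop_of k)
  - (1 + d) * \sum_j damping j * omega y j ^+ 2.
Proof.
move=> [etaE omE xE psiE pcE]; rewrite /energy_rate.
have -> : \sum_(e : line P) suscept e * (eta y e * eta dy e) =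
    \sum_j omega y j * bus_outflow y j.
  under [RHS]eq_bigr do rewrite mulr_sumr.
  rewrite exchange_big/=; apply: eq_bigr => e _; rewrite etaE !mulr_sumr.
  by apply: eq_bigr => j _; ring.
have -> : \sum_j inertia j * (omega y j * omega dy j) =
    - (\sum_(k : unit_ P) omega y (unit_bus k) * response y k)
    - \sum_j damping j * omega y j ^+ 2 - \sum_j omega y j * bus_outflow y j.
  rewrite -(sum_over_buses (omega y)) -!sumrN -!big_split/=.
  by apply: eq_bigr => j _; rewrite mulrCA omE; ring.
have -> : \sum_g tau g / droop g * (xg y g * xg dy g) =
    \sum_(k : unit_ P) (gen_state y k * (pc y k - omega y (unit_bus k))
                        - gen_state y k ^+ 2 / droop_of k).
  rewrite big_sumType/= [X in _ = _ + X]big1 ?addr0; last first.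
    by move=> l _; rewrite expr0n/= !mul0r subrr.
  apply: eq_bigr => g _; have m0 := droop_gt0 g.
  rewrite (_ : _ * _ = (tau g * xg dy g) * xg y g / droop g); last by ring.
  by rewrite xE; field; rewrite gt_eqF.
have -> : \sum_(e : link P) psi_rate e * (psi y e * psi dy e) =
    \sum_(k : unit_ P) pc y k * link_outflow y k.
  under [RHS]eq_bigr do rewrite mulr_sumr.
  rewrite exchange_big/=; apply: eq_bigr => e _; rewrite mulrCA psiE mulr_sumr.
  by apply: eq_bigr => k _; ring.
have -> : \sum_(k : unit_ P) ((pc_rate k + xi k) * (pc y k * pc dy k)
      + dxi k / 2 * pc y k ^+ 2) =
    \sum_(k : unit_ P) (pc y k * response y k + pc y k * nf k
      + dxi k / 2 * pc y k ^+ 2)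
    - \sum_(k : unit_ P) pc y k * link_outflow y k.
  by rewrite -sumrN -big_split/=; apply: eq_bigr => k _; rewrite mulrCA pcE; ring.
set A := \sum_j _ * bus_outflow y j; set B := \sum_k _ * response y k.
set G := \sum_k _ * link_outflow y k; set D := \sum_j damping j * _.
set C := \sum_k (_ - _); set F := \sum_k (_ + _); set S := \sum_k _.
suff -> : S = - (1 + d) * B + C + F by ring.
rewrite /S /B /C /F mulr_sumr -!big_split/=; apply: eq_bigr => k _.
by rewrite /response; ring.
Qed.

(** The shares at a bus add up to its damping if it carries units, and to zero otherwise; hence only
    an inequality. *)
Lemma damping_share_sum_le (w : bus P -> R) :
  \sum_(k : unit_ P) damping_share k * w (unit_bus k) ^+ 2 <=
  \sum_j damping j * w j ^+ 2.
Proof.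
rewrite (partition_big (@unit_bus R P) predT)//=; apply: ler_sum => j _.
have Dw0 : 0 <= damping j * w j ^+ 2 by rewrite mulr_ge0 ?sqr_ge0 ?ltW ?damping_gt0.
rewrite (eq_bigr (fun=> damping j / #|units_at j|%:R * w j ^+ 2)); last first.
  by move=> k /eqP kj; rewrite /damping_share kj.
rewrite (eq_bigl (fun k => k \in units_at j)); last by move=> k; rewrite inE.
rewrite sumr_const -[X in X <= _]mulr_natr mulrAC.
have [->|n0] := eqVneq #|units_at j| 0%N; first by rewrite mulr0 mul0r.
by rewrite divfK// pnatr_eq0.
Qed.

Section Dissipation.
Variables beta betahat : unit_ P -> R.
Hypothesis beta_gt0 : forall k, 0 < beta k.
Hypothesis betahat_gt0 : forall k, 0 < betahat k.
Hypothesis lmi : forall k, neg_semidefinite (privacy_lmi beta betahat k).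

Lemma droop_of_gt0 k : 0 < droop_of k.
Proof. by case: k => [g|l] //=; exact: droop_gt0. Qed.

Lemma energy_dissipation : exists2 d, 0 < d & exists2 c, 0 < c &
  forall y dy xi dxi nf, error_dynamics y dy xi nf ->
  (forall k, `|nf k| <= beta k * `|omega y (unit_bus k)|) ->
  (forall k, dxi k <= betahat k) ->
  energy_rate d y dy xi dxi <= - (c * damped_sqn y).
Proof.
have [d d0 hd] := finite_lower_bound
  (fun k => unit_dissipation beta_gt0 lmi k (droop_of_gt0 k)).
have [s s0 hs] := finite_lower_bound (fun k => hd k _ d0 (lexx d)).
exists d => //.
have [c c0 hc] := weighted_sum_ge (@damping_gt0 R P).
(* The cap at [1] makes [1 + d - r] nonnegative, so that [damping_share_sum_le] can be scaled by it.
   The damping held back then gives dissipation [r] times the damping at every bus, including those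
   without units. *)
pose r := Num.min s 1.
have r0 : 0 < r by rewrite lt_min s0 ltr01.
have rs : r <= s by rewrite ge_min lexx.
have r1 : r <= 1 by rewrite ge_min lexx orbT.
exists (r * Num.min 1 c); first by rewrite mulr_gt0// lt_min ltr01.
move=> y dy xi dxi nf dyn hnf hdxi; rewrite (energy_rateE d dxi dyn).
have damp := damping_share_sum_le (omega y).
have := hc _ (fun j => sqr_ge0 (omega y j)); rewrite -/(sqn _) => hom.
have units : \sum_(k : unit_ P) (d * (omega y (unit_bus k) * gen_state y k)
    + (2 + d) * gain k * (omega y (unit_bus k) * pc y k)
    - (1 + d) * gain k * omega y (unit_bus k) ^+ 2
    - gain k * pc y k ^+ 2 + pc y k * nf k + dxi k / 2 * pc y k ^+ 2
    - gen_state y k ^+ 2 / droop_of k) <=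
  (1 + d - r) * (\sum_(k : unit_ P) damping_share k * omega y (unit_bus k) ^+ 2)
  - r * (sqn (gen_state y) + sqn (pc y)).
  rewrite /sqn -big_split/= !mulr_sumr -sumrB; apply: ler_sum => k _.
  by have := hs k r r0 rs _ (pc y k) (gen_state y k) _ _ (hnf k) (hdxi k); lra.
have damp' := ler_wpM2l (_ : 0 <= 1 + d - r) damp.
have {}damp' := damp' ltac:(lra).
have om0 := sqn_ge0 (omega y); have x0 := sqn_ge0 (gen_state y).
have p0 := sqn_ge0 (pc y).
rewrite /damped_sqn.
set m := Num.min 1 c.
have m1 : m <= 1 by rewrite ge_min lexx.
have mc : m <= c by rewrite ge_min lexx orbT.
have h1 : r * (m * sqn (omega y)) <= r * (\sum_j damping j * omega y j ^+ 2).
  by rewrite ler_pM2l//; apply: le_trans hom; rewrite ler_wpM2r.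
have h2 : r * (m * (sqn (gen_state y) + sqn (pc y))) <=
    r * (sqn (gen_state y) + sqn (pc y)).
  by rewrite ler_pM2l// ler_piMl// addr_ge0.
move: units damp' h1 h2 hom.
set U := \sum_k _; set D := \sum_j _; set V := \sum_k _; move=> *; lra.
Qed.

End Dissipation.

End ErrorDynamics.

(** * Bounds on the cross term and the dissipation it adds *)

Section CrossTerm.
Context {R : realType} {P : network R}.

Lemma sqn_gen_state (y : state P) : sqn (gen_state y) = sqn (xg y).
Proof.
rewrite /sqn big_sumType/= [X in _ + X]big1 ?addr0// => l _.
by rewrite expr0n.
Qed.

Lemma bus_value_bound (w : unit_ P -> R) :
  exists2 C, 0 < C & forall om : bus P -> R,
    sqn (fun k => w k * om (unit_bus k)) <= C * sqn om.
Proof.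
have [C C0 hC] := linear_image_bound
  (fun (k : unit_ P) (j : bus P) => w k * (unit_bus k == j)%:R).
exists C => // om; apply: hC => k.
rewrite (bigD1 (unit_bus k))//= eqxx mulr1 big1 ?addr0// => j jk.
by rewrite eq_sym (negPf jk) mulr0 mul0r.
Qed.

Lemma response_bound : exists2 C, 0 < C & forall y : state P,
  sqn (response y) <= C * damped_sqn y.
Proof.
have [C1 C10 h1] := diagonal_bound (fun k : unit_ P => gain k).
have [C2 C20 h2] := bus_value_bound (fun k : unit_ P => gain k).
exists (3 * (1 + C1 + C2)); first by rewrite mulr_gt0 ?addr_gt0.
move=> y; have := h1 (pc y); have := h2 (omega y).
set p := sqn (fun k => _ * pc y k); set om := sqn (fun k => _ * _ (unit_bus k)).
have x0 := sqn_ge0 (gen_state y); have om0 := sqn_ge0 (omega y).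
have p0 := sqn_ge0 (pc y) => hom hp.
have : sqn (response y) <= 3 * (sqn (gen_state y) + p + om).
  rewrite /p /om /sqn -!big_split/= mulr_sumr; apply: ler_sum => k _.
  rewrite /response /=; set x := gen_state y k; set a := omega _ _.
  set b := pc _ _; set h := gain _.
  rewrite -subr_ge0 [X in 0 <= X](_ : _ =
    (x - h * b) ^+ 2 + (x + h * a) ^+ 2 + (h * b + h * a) ^+ 2); last by ring.
  by rewrite !addr_ge0 ?sqr_ge0.
rewrite /damped_sqn; set X := sqn (gen_state y); set B := sqn (pc y) in p0 hp *.
set A := sqn (omega y) in om0 hom * => h.
have hs : 0 <= C1 * X /\ 0 <= C1 * A /\ 0 <= C2 * X /\ 0 <= C2 * B.
  by do !split; apply: mulr_ge0 => //; exact: ltW.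
lra.
Qed.

Lemma link_outflow_bound : exists2 C, 0 < C & forall y : state P,
  sqn (link_outflow y) <= C * sqn (psi y).
Proof.
have [C C0 hC] := linear_image_bound
  (fun (k : unit_ P) (e : link P) => incidence R k e).
by exists C => // y; exact: hC.
Qed.

Lemma bus_outflow_bound : exists2 C, 0 < C & forall y : state P,
  sqn (bus_outflow y) <= C * sqn (eta y).
Proof.
have [C C0 hC] := linear_image_bound
  (fun (j : bus P) (e : line P) => incidence R j e * suscept e).
by exists C => // y; apply: hC => j; apply: eq_bigr => e _; rewrite mulrA.
Qed.

Lemma net_load_bound : exists2 C, 0 < C & forall y : state P,
  sqn (fun j => \sum_(k : unit_ P | unit_bus k == j) response y k
                + damping j * omega y j) <= C * damped_sqn y.
Proof.
have [C1 C10 h1] := response_bound.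
have [C2 C20 h2] := linear_image_bound
  (fun (j : bus P) (k : unit_ P) => (unit_bus k == j)%:R : R).
have [C3 C30 h3] := diagonal_bound (fun j : bus P => damping j).
exists (2 * (C2 * C1) + 2 * C3); first by rewrite addr_gt0 ?mulr_gt0.
move=> y; apply: (le_trans (sqnD _ _)).
rewrite (mulrDl (2 * (C2 * C1))); apply: lerD.
  rewrite -!mulrA ler_pM2l//.
  apply: le_trans (ler_wpM2l (ltW C20) (h1 y)); apply: h2 => j.
  rewrite big_mkcond/=; apply: eq_bigr => k _.
  by case: eqP => _; rewrite ?mul1r ?mul0r.
rewrite -mulrA ler_pM2l//; apply: (le_trans (h3 _)); rewrite ler_pM2l//.
by rewrite /damped_sqn; have := sqn_ge0 (gen_state y); have := sqn_ge0 (pc y); lra.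
Qed.

Lemma cross_bound : exists2 C, 0 < C & forall y : state P,
  `|cross y| <= C * (sqn (eta y) + sqn (psi y) + damped_sqn y).
Proof.
have [C1 C10 h1] := link_outflow_bound; have [C2 C20 h2] := bus_outflow_bound.
have [C3 C30 h3] := diagonal_bound (fun j : bus P => inertia j).
exists (1 + C1 + C2 + C3); first by rewrite !addr_gt0.
move=> y; apply: (le_trans (ler_normD _ _)).
have := ler_norm_sum_mul (pc y) (link_outflow y).
have := ler_norm_sum_mul (fun j => inertia j * omega y j) (bus_outflow y).
have := h1 y; have := h2 y; have := h3 (omega y).
rewrite /damped_sqn; have := sqn_ge0 (gen_state y); have := sqn_ge0 (pc y).
have := sqn_ge0 (omega y); have := sqn_ge0 (eta y); have := sqn_ge0 (psi y).
have := sqn_ge0 (bus_outflow y); have := sqn_ge0 (link_outflow y).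
move: (sqn (gen_state y)) (sqn (pc y)) (sqn (omega y)) (sqn (eta y))
  (sqn (psi y)) (sqn (bus_outflow y)) (sqn (link_outflow y))
  (sqn (fun j => inertia j * omega y j)).
move=> x p o e s q g mo g0 q0 s0 e0 o0 p0 x0 hmo hq hg.
have pos (c z : R) : 0 < c -> 0 <= z -> 0 <= c * z by move=> *; rewrite mulr_ge0// ltW.
have := pos _ _ C10 e0; have := pos _ _ C10 o0; have := pos _ _ C10 p0.
have := pos _ _ C20 o0; have := pos _ _ C20 p0; have := pos _ _ C20 s0.
have := pos _ _ C30 e0; have := pos _ _ C30 s0; have := pos _ _ C30 p0.
have := pos _ _ C10 x0; have := pos _ _ C20 x0; have := pos _ _ C30 x0.
have := pos _ _ C10 s0; have := pos _ _ C20 e0; have := pos _ _ C30 o0.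
lra.
Qed.

(** Differentiating [pc] and [omega] produces the two negative squares of the outflows, half of
    which survive Young's inequality ([T1], [T3]). Differentiating [psi] and [eta] gives only
    quantities linear in [pc] and [omega] ([T2], [T4]). The constant does not depend on [xi]: the
    errors divided by [pc_rate + xi] are at most those divided by [pc_rate]. *)
Lemma cross_dissipation (beta : unit_ P -> R) :
  exists2 C, 0 < C & forall y dy xi nf, error_dynamics y dy xi nf ->
  (forall k, 0 <= xi k) ->
  (forall k, `|nf k| <= beta k * `|omega y (unit_bus k)|) ->
  cross_rate y dy <= C * damped_sqn y
    - (\sum_(k : unit_ P) link_outflow y k ^+ 2 / (pc_rate k + xi k)
       + sqn (bus_outflow y)) / 2.
Proof.
have [C1 C10 h1] := response_bound; have [C2 C20 h2] := bus_value_bound beta.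
have [C3 C30 h3] := weighted_sum_le (fun k : unit_ P => (2 * pc_rate k)^-1).
have [C4 C40 h4] := link_outflow_bound.
have [C5 C50 h5] := linear_image_bound
  (fun (e : link P) (k : unit_ P) => incidence R k e / psi_rate e).
have [C6 C60 h6] := net_load_bound; have [C7 C70 h7] := bus_outflow_bound.
have [C8 C80 h8] := linear_image_bound
  (fun (e : line P) (j : bus P) => incidence R j e).
have [C9 C90 h9] := diagonal_bound (fun j : bus P => inertia j).
exists (C3 * (2 * C1 + 2 * C2) + (1 + C4 * C5) + C6 + (C9 + C7 * C8)).
  by rewrite !addr_gt0 ?mulr_gt0 ?addr_gt0 ?mulr_gt0.
move=> y dy xi nf [etaE omE _ psiE pcE] xi0 hnf.
set S := damped_sqn y.
have x0 := sqn_ge0 (gen_state y); have om0 := sqn_ge0 (omega y).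
have p0 := sqn_ge0 (pc y).
have omS : sqn (omega y) <= S by rewrite /S /damped_sqn; lra.
have pS : sqn (pc y) <= S by rewrite /S /damped_sqn; lra.
have S0 : 0 <= S by exact: le_trans omS.
have scale (c z : R) : 0 < c -> z <= S -> c * z <= c * S by move=> *; rewrite ler_pM2l.
have T1 : \sum_(k : unit_ P) pc dy k * link_outflow y k <=
    C3 * (2 * C1 + 2 * C2) * S
    - (\sum_(k : unit_ P) link_outflow y k ^+ 2 / (pc_rate k + xi k)) / 2.
  have nf2 : sqn nf <= C2 * S.
    apply: le_trans (scale _ _ C20 omS); apply: le_trans (h2 _).
    apply: ler_sum => k _; rewrite -real_normK ?num_real// -[leRHS]real_normK ?num_real//.
    rewrite ler_pXn2r ?nnegrE ?normr_ge0//; apply: (le_trans (hnf k)).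
    by rewrite normrM ler_wpM2r// ler_norm.
  have u2 : sqn (fun k => response y k + nf k) <= (2 * C1 + 2 * C2) * S.
    by apply: (le_trans (sqnD _ _)); have := h1 y; rewrite -/S; lra.
  have := h3 _ (fun k => sqr_ge0 (response y k + nf k)); rewrite -/(sqn _) => w2.
  have := ler_wpM2l (ltW C30) u2; rewrite mulrA => /(le_trans w2) {}w2.
  rewrite -lerBlDr; apply: le_trans w2.
  rewrite mulr_suml opprK -big_split/=; apply: ler_sum => k _.
  have c0 := pc_rate_gt0 k; have cx0 : 0 < pc_rate k + xi k by have := xi0 k; lra.
  have -> : pc dy k = (response y k + nf k - link_outflow y k) / (pc_rate k + xi k).
    by apply: (mulfI (lt0r_neq0 cx0)); rewrite pcE mulrCA mulfV ?gt_eqF// mulr1; ring.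
  set u := _ + nf k; set g := link_outflow y k; set c := pc_rate k + xi k in cx0 *.
  apply: (@le_trans _ _ (u ^+ 2 / (2 * c))).
    rewrite -subr_ge0 [X in 0 <= X](_ : _ = (u - g) ^+ 2 / (2 * c)).
      by rewrite divr_ge0 ?sqr_ge0// mulr_ge0// ltW.
    by field; rewrite gt_eqF.
  rewrite mulrC ler_wpM2r ?sqr_ge0// lef_pV2 ?posrE ?mulr_gt0//.
  by rewrite ler_pM2l// lerDl.
have T2 : \sum_(k : unit_ P) pc y k * link_outflow dy k <= (1 + C4 * C5) * S.
  apply: (le_trans (ler_norm _)); apply: (le_trans (ler_norm_sum_mul _ _)).
  have hpsi : sqn (psi dy) <= C5 * sqn (pc y).
    apply: h5 => e; apply: (mulfI (lt0r_neq0 (psi_rate_gt0 e))).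
    rewrite psiE mulr_sumr; apply: eq_bigr => k _.
    by field; rewrite gt_eqF// psi_rate_gt0.
  have := h4 dy; have := ler_wpM2l (ltW C40) hpsi.
  have := scale _ _ (mulr_gt0 C40 C50) pS.
  have : 0 <= C4 * C5 * S by rewrite mulr_ge0// ltW// mulr_gt0.
  lra.
have T3 : \sum_j inertia j * omega dy j * bus_outflow y j <=
    C6 * S - sqn (bus_outflow y) / 2.
  have := h6 y; rewrite -/S; set w := sqn _ => hw.
  have w0 : 0 <= w := sqn_ge0 _.
  apply: (@le_trans _ _ (w / 2 - sqn (bus_outflow y) / 2)); last by lra.
  rewrite /w /sqn !mulr_suml -sumrB; apply: ler_sum => j _.
  rewrite omE; set a := \sum_(_ | _) _; set b := damping j * _.
  set q := bus_outflow y j.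
  rewrite -subr_ge0 [X in 0 <= X](_ : _ = (a + b + q) ^+ 2 / 2); last by field.
  by rewrite divr_ge0 ?sqr_ge0.
have T4 : \sum_j inertia j * omega y j * bus_outflow dy j <= (C9 + C7 * C8) * S.
  apply: (le_trans (ler_norm _)); apply: (le_trans (ler_norm_sum_mul _ _)).
  have heta : sqn (eta dy) <= C8 * sqn (omega y) by apply: h8 => e; exact: etaE.
  have := h7 dy; have := ler_wpM2l (ltW C70) heta; have := h9 (omega y).
  have := scale _ _ (mulr_gt0 C70 C80) omS; have := scale _ _ C90 omS.
  have : 0 <= C7 * C8 * S by rewrite mulr_ge0// ltW// mulr_gt0.
  have : 0 <= C9 * S by rewrite mulr_ge0// ltW.
  lra.
rewrite /cross_rate !big_split/=; move: T1 T2 T3 T4.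
move: (\sum_(k : unit_ P) pc dy k * _) (\sum_(k : unit_ P) pc y k * _).
move: (\sum_j _ * bus_outflow y j) (\sum_j _ * bus_outflow dy j).
move: (\sum_k _ / (_ + _)) => *; lra.
Qed.

End CrossTerm.

(** * The Lyapunov inequality with its constants *)

Section Lyapunov.
Context {R : realType} {P : network R}.

Lemma energy_coercive (d : R) : 0 <= d -> exists2 c, 0 < c &
  forall (y : state P) xi, (forall k, 0 <= xi k) ->
  c * (sqn (eta y) + sqn (psi y) + damped_sqn y) <= energy d y xi.
Proof.
move=> d0; have [c1 c10 h1] := weighted_sum_ge (@suscept_gt0 R P).
have [c2 c20 h2] := weighted_sum_ge (@inertia_gt0 R P).
have [c3 c30 h3] := weighted_sum_ge
  (fun g : gen P => divr_gt0 (tau_gt0 g) (droop_gt0 g)).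
have [c4 c40 h4] := weighted_sum_ge (@psi_rate_gt0 R P).
have [c5 c50 h5] := weighted_sum_ge (@pc_rate_gt0 R P).
pose c := Num.min c1 (Num.min c2 (Num.min c3 (Num.min c4 c5))).
have c0 : 0 < c by rewrite !lt_min c10 c20 c30 c40 c50.
have /and5P[cc1 cc2 cc3 cc4 cc5] : [&& c <= c1, c <= c2, c <= c3, c <= c4 & c <= c5].
  by rewrite -!le_min.
exists (c / 2); first by rewrite divr_gt0.
move=> y xi xi0; rewrite /damped_sqn sqn_gen_state /energy.
have : c1 * sqn (eta y) <= _ := h1 _ (fun e => sqr_ge0 _).
have : c2 * sqn (omega y) <= _ := h2 _ (fun j => sqr_ge0 _).
have : c3 * sqn (xg y) <= _ := h3 _ (fun g => sqr_ge0 _).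
have : c4 * sqn (psi y) <= _ := h4 _ (fun e => sqr_ge0 _).
have : c5 * sqn (pc y) <= _ := h5 _ (fun k => sqr_ge0 _).
have : \sum_(k : unit_ P) pc_rate k * pc y k ^+ 2 <=
    \sum_(k : unit_ P) (pc_rate k + xi k) * pc y k ^+ 2.
  by apply: ler_sum => k _; rewrite ler_wpM2r ?sqr_ge0// lerDl.
have mono c' (v : R) : c <= c' -> 0 <= v -> c * v <= c' * v.
  by move=> *; rewrite ler_wpM2r.
have := mono _ _ cc1 (sqn_ge0 (eta y)); have := mono _ _ cc2 (sqn_ge0 (omega y)).
have := mono _ _ cc3 (sqn_ge0 (xg y)); have := mono _ _ cc4 (sqn_ge0 (psi y)).
have := mono _ _ cc5 (sqn_ge0 (pc y)).
set E := \sum_e suscept e * _; set O := \sum_j inertia j * _; set X := \sum_g _ / _ * _.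
set Ps := \sum_(e : link P) psi_rate e * _; set PC := \sum_(k : unit_ P) pc_rate k * pc y k ^+ 2.
set PX := \sum_(k : unit_ P) (pc_rate k + xi k) * pc y k ^+ 2 => *.
have nn (v : R) : 0 <= v -> 0 <= c * v by move=> v0; rewrite mulr_ge0// ltW.
have := nn _ (sqn_ge0 (eta y)); have := nn _ (sqn_ge0 (omega y)) => *.
have : 0 <= d * (E + O) by rewrite mulr_ge0//; lra.
lra.
Qed.

(** Here [t] stands for one plus the time. The factor [t] falls only on components that the energy
    dissipates at a constant rate; [eta] and [psi] have constant weights. *)
Lemma energy_upper (d a : R) : 0 <= d -> 0 < a -> exists2 C, 0 < C &
  forall (y : state P) xi t, 1 <= t -> (forall k, pc_rate k + xi k <= a * t) ->
  energy d y xi <= C * (sqn (eta y) + sqn (psi y) + t * damped_sqn y).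
Proof.
move=> d0 a0; have [c1 c10 h1] := weighted_sum_le (@suscept R P).
have [c2 c20 h2] := weighted_sum_le (@inertia R P).
have [c3 c30 h3] := weighted_sum_le (fun g : gen P => tau g / droop g).
have [c4 c40 h4] := weighted_sum_le (@psi_rate R P).
pose C := (1 + d) * (c1 + c2) + c3 + c4 + a.
have d1 : 0 < 1 + d by lra.
exists C; first by have := mulr_gt0 d1 (addr_gt0 c10 c20); rewrite /C; lra.
move=> y xi t t1 hxi; rewrite /damped_sqn sqn_gen_state /energy.
have : _ <= c1 * sqn (eta y) := h1 _ (fun e => sqr_ge0 _).
have : _ <= c2 * sqn (omega y) := h2 _ (fun j => sqr_ge0 _).
have : _ <= c3 * sqn (xg y) := h3 _ (fun g => sqr_ge0 _).
have : _ <= c4 * sqn (psi y) := h4 _ (fun e => sqr_ge0 _).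
have : \sum_(k : unit_ P) (pc_rate k + xi k) * pc y k ^+ 2 <= a * t * sqn (pc y).
  by rewrite mulr_sumr; apply: ler_sum => k _; rewrite ler_wpM2r ?sqr_ge0.
have e0 := sqn_ge0 (eta y); have s0 := sqn_ge0 (psi y).
have o0 := sqn_ge0 (omega y); have x0 := sqn_ge0 (xg y); have p0 := sqn_ge0 (pc y).
set E := \sum_e suscept e * _; set O := \sum_j inertia j * _; set X := \sum_g _ / _ * _.
set Ps := \sum_(e : link P) psi_rate e * _; set PX := \sum_(k : unit_ P) (pc_rate k + xi k) * pc y k ^+ 2.
move: e0 s0 o0 x0 p0.
move: (sqn (eta y)) (sqn (psi y)) (sqn (omega y)) (sqn (xg y)) (sqn (pc y)).
move=> e s o x p e0 s0 o0 x0 p0 hPX hPs hX hO hE.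
have tmul (v : R) : 0 <= v -> v <= t * v.
  by move=> v0; rewrite -[leLHS]mul1r ler_wpM2r.
have hd : (1 + d) * (E + O) <= (1 + d) * (c1 * e + c2 * (t * o)).
  rewrite ler_pM2l; last lra.
  have : c2 * o <= c2 * (t * o) by rewrite ler_pM2l// tmul.
  lra.
have hc3 : c3 * x <= c3 * (t * x) by rewrite ler_pM2l// tmul.
pose D1 := (1 + d) * c1; pose D2 := (1 + d) * c2.
have D10 : 0 < D1 by rewrite mulr_gt0//; lra.
have D20 : 0 < D2 by rewrite mulr_gt0//; lra.
have to0 : 0 <= t * o by rewrite mulr_ge0//; lra.
have tx0 : 0 <= t * x by rewrite mulr_ge0//; lra.
have tp0 : 0 <= t * p by rewrite mulr_ge0//; lra.
have {}hd : (1 + d) * (E + O) <= D1 * e + D2 * (t * o) by rewrite /D1 /D2; lra.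
have -> : C * (e + s + t * (x + o + p)) =
    (D1 + D2 + c3 + c4 + a) * (e + s + (t * x + t * o + t * p)).
  by rewrite /C /D1 /D2; ring.
have {}hPX : PX <= a * (t * p) by rewrite mulrA.
have nn (c v : R) : 0 < c -> 0 <= v -> 0 <= c * v by move=> *; rewrite mulr_ge0// ltW.
have := nn _ _ D10 e0; have := nn _ _ D10 s0; have := nn _ _ D10 tx0.
have := nn _ _ D10 to0; have := nn _ _ D10 tp0.
have := nn _ _ D20 e0; have := nn _ _ D20 s0; have := nn _ _ D20 tx0.
have := nn _ _ D20 to0; have := nn _ _ D20 tp0.
have := nn _ _ c30 e0; have := nn _ _ c30 s0; have := nn _ _ c30 tx0.
have := nn _ _ c30 to0; have := nn _ _ c30 tp0.
have := nn _ _ c40 e0; have := nn _ _ c40 s0; have := nn _ _ c40 tx0.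
have := nn _ _ c40 to0; have := nn _ _ c40 tp0.
have := nn _ _ a0 e0; have := nn _ _ a0 s0; have := nn _ _ a0 tx0.
have := nn _ _ a0 to0; have := nn _ _ a0 tp0.
move: hPX hPs hX hc3 hd; clear.
move: (t * x) (t * o) (t * p) => tx to tp *; lra.
Qed.

Variables beta betahat : unit_ P -> R.
Hypothesis beta_gt0 : forall k, 0 < beta k.
Hypothesis betahat_gt0 : forall k, 0 < betahat k.
Hypothesis lmi : forall k, neg_semidefinite (privacy_lmi beta betahat k).

(** The two hypotheses with [K] encode that the deviations of [eta] and [psi] are gradients; they
    turn dissipation in the outflows into dissipation in the states. As above, [t] is one plus the
    time. *)
Lemma lyapunov_inequality (a K : R) : 0 < a -> 0 < K ->
  exists d th c c' : R, [/\ 0 < c, 0 < c' &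
  forall (y dy : state P) xi dxi nf t, error_dynamics y dy xi nf ->
  (forall k, `|nf k| <= beta k * `|omega y (unit_bus k)|) ->
  (forall k, dxi k <= betahat k) -> (forall k, 0 <= xi k) ->
  1 <= t -> (forall k, pc_rate k + xi k <= a * t) ->
  sqn (eta y) <= K * sqn (bus_outflow y) ->
  sqn (psi y) <= K * sqn (link_outflow y) ->
  c * (sqn (eta y) + sqn (psi y) + damped_sqn y) <= energy d y xi + th * cross y /\
  energy_rate d y dy xi dxi + th * cross_rate y dy <=
    - (c' / t * (energy d y xi + th * cross y))].
Proof.
move=> a0 K0.
have [d d0 [k k0 hk]] := energy_dissipation beta_gt0 lmi.
have [C C0 hC] := cross_dissipation beta.
have [Cx Cx0 hCx] := @cross_bound R P.
have [cE cE0 hcE] := energy_coercive (ltW d0).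
have [CE CE0 hCE] := energy_upper (ltW d0) a0.
(* The first bound lets the error of the cross term consume at most half of the damping, the second
   lets the cross term itself consume at most half of the coercivity. *)
pose th := Num.min (k / (2 * C)) (cE / (2 * Cx)).
have th0 : 0 < th by rewrite lt_min !divr_gt0 ?mulr_gt0.
have thC : th * C <= k / 2.
  have : th <= k / (2 * C) by rewrite ge_min lexx.
  by rewrite ler_pdivlMr ?mulr_gt0//; lra.
have thCx : th * Cx <= cE / 2.
  have : th <= cE / (2 * Cx) by rewrite ge_min lexx orbT.
  by rewrite ler_pdivlMr ?mulr_gt0//; lra.
pose CW := CE + th * Cx.
have CW0 : 0 < CW by rewrite addr_gt0 ?mulr_gt0.
(* One bound per dissipated quantity: the damped components, [bus_outflow], and [link_outflow]; the
   last carries [a] because its dissipation is divided by [pc_rate + xi <= a * t]. *)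
pose c' := Num.min (k / (2 * CW)) (Num.min (th / (2 * (CW * K)))
  (th / (2 * (a * (CW * K))))).
have c'0 : 0 < c' by rewrite !lt_min !divr_gt0 ?mulr_gt0.
have c'k : c' * CW <= k / 2.
  have : c' <= k / (2 * CW) by rewrite !ge_min lexx.
  by rewrite ler_pdivlMr ?mulr_gt0//; lra.
have c'q : c' * (CW * K) <= th / 2.
  have : c' <= th / (2 * (CW * K)) by rewrite !ge_min lexx !orbT.
  by rewrite ler_pdivlMr ?mulr_gt0//; lra.
have c'g : a * (c' * (CW * K)) <= th / 2.
  have : c' <= th / (2 * (a * (CW * K))) by rewrite !ge_min lexx !orbT.
  by rewrite ler_pdivlMr ?mulr_gt0//; lra.
exists d, th, (cE / 2), c'; split => //; first by rewrite divr_gt0.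
move=> y dy xi dxi nf t dyn hnf hdxi xi0 t1 hxi hq hg.
have := hcE y xi xi0; have := hCE y xi t t1 hxi; have := hCx y.
have := hk y dy xi dxi nf dyn hnf hdxi; have := hC y dy xi nf dyn xi0 hnf.
have t0 : 0 < t by lra.
have x0 : 0 <= damped_sqn y by rewrite /damped_sqn !addr_ge0 ?sqn_ge0.
have at0 : 0 < a * t by rewrite mulr_gt0.
have : sqn (link_outflow y) <=
    a * t * \sum_(l : unit_ P) link_outflow y l ^+ 2 / (pc_rate l + xi l).
  rewrite mulr_sumr; apply: ler_sum => l _.
  have cx0 : 0 < pc_rate l + xi l by rewrite ltr_pwDl ?pc_rate_gt0.
  by rewrite mulrCA ler_peMr ?sqr_ge0// ler_pdivlMr// mul1r.
have := sqn_ge0 (eta y); have := sqn_ge0 (psi y).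
have := sqn_ge0 (bus_outflow y); have := sqn_ge0 (link_outflow y).
move: hq hg x0; rewrite ler_norml.
move: (sqn (eta y)) (sqn (psi y)) (damped_sqn y) (sqn (bus_outflow y))
  (sqn (link_outflow y)) (cross y) (energy d y xi) (cross_rate y dy)
  (energy_rate d y dy xi dxi) (\sum_l _ / _).
move=> e s x q g X E dX dE G hq hg x0 g0 q0 s0 e0 hG hdX hdE /andP[hX1 hX2] hE1 hE2.
have thX : th * X <= th * Cx * (e + s + x) by rewrite -mulrA ler_pM2l.
have thX' : - (th * Cx * (e + s + x)) <= th * X by rewrite -mulrA -mulrN ler_pM2l.
have thN : th * Cx * (e + s + x) <= cE / 2 * (e + s + x) by rewrite ler_wpM2r//; lra.
split; first lra.
have tx : x <= t * x by rewrite -[leLHS]mul1r ler_wpM2r.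
have W1 : E + th * X <= CW * (K * q + K * g + t * x).
  have h : th * Cx * (e + s + x) <= th * Cx * (e + s + t * x).
    by rewrite ler_pM2l ?mulr_gt0//; lra.
  apply: (@le_trans _ _ (CW * (e + s + t * x))); first by rewrite /CW; lra.
  by rewrite ler_pM2l//; lra.
have W2 : c' * (E + th * X) <=
    c' * (CW * K) * q + c' * (CW * K) * g + c' * CW * (t * x).
  by apply: (le_trans (ler_wpM2l (ltW c'0) W1)); lra.
have r1 : c' * (CW * K) * q <= th / 2 * q by rewrite ler_wpM2r.
have r2 : c' * (CW * K) * g <= th / 2 * (t * G).
  apply: (@le_trans _ _ (c' * (CW * K) * (a * t * G))).
    by rewrite ler_pM2l ?mulr_gt0.
  rewrite (_ : _ * (a * t * G) = a * (c' * (CW * K)) * (t * G)); last by ring.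
  rewrite ler_wpM2r// -(pmulr_rge0 _ a0) mulrA; exact: le_trans hG.
have r3 : c' * CW * (t * x) <= k / 2 * (t * x) by rewrite ler_wpM2r//; lra.
have r4 : th / 2 * q <= th / 2 * (t * q).
  by rewrite ler_pM2l ?divr_gt0// -[leLHS]mul1r; exact: ler_wpM2r.
have thdX : th * dX <= th * (C * x - (G + q) / 2) by rewrite ler_pM2l.
have thCx' : th * C * x <= k / 2 * x by rewrite ler_wpM2r.
have D : dE + th * dX <= - (k / 2 * x + th / 2 * (G + q)) by lra.
apply: (le_trans D); rewrite lerN2 mulrAC ler_pdivrMr//.
by apply: (le_trans W2); lra.
Qed.

End Lyapunov.

(** * The formal rates are derivatives along trajectories *)

Section LyapunovDerivative.
Context {R : realType} {P : network R}.
Variables (Y : R -> state P) (dY : state P) (t : R).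
Hypothesis eta_d : forall e, is_derive t 1 (fun s => eta (Y s) e) (eta dY e).
Hypothesis psi_d : forall e, is_derive t 1 (fun s => psi (Y s) e) (psi dY e).
Hypothesis omega_d : forall j, is_derive t 1 (fun s => omega (Y s) j) (omega dY j).
Hypothesis xg_d : forall g, is_derive t 1 (fun s => xg (Y s) g) (xg dY g).
Hypothesis pc_d : forall k, is_derive t 1 (fun s => pc (Y s) k) (pc dY k).

Lemma is_derive_weighted_sqr (c : R) (f : R -> R) (df : R) :
  is_derive t 1 f df ->
  is_derive t 1 (fun s => c * f s ^+ 2) (c * (2 * (f t * df))).
Proof. by move=> fd; apply: is_derive_mull; exact: is_derive_sqr. Qed.

Lemma is_derive_bus_outflow j :
  is_derive t 1 (fun s => bus_outflow (Y s) j) (bus_outflow dY j).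
Proof. by apply: is_derive_fsum => e; do 2!apply: is_derive_mull. Qed.

Lemma is_derive_link_outflow k :
  is_derive t 1 (fun s => link_outflow (Y s) k) (link_outflow dY k).
Proof. by apply: is_derive_fsum => e; apply: is_derive_mull. Qed.

Lemma is_derive_cross :
  is_derive t 1 (fun s => cross (Y s)) (cross_rate (Y t) dY).
Proof.
have h1 k := is_derive_mul (pc_d k) (is_derive_link_outflow k).
have h2 j := is_derive_mul (is_derive_mull (inertia j) (omega_d j))
  (is_derive_bus_outflow j).
exact: is_deriveD (is_derive_fsum xpredT h1) (is_derive_fsum xpredT h2).
Qed.

Lemma is_derive_energy d (xi : unit_ P -> R -> R) (dxi : unit_ P -> R) :
  (forall k, is_derive t 1 (xi k) (dxi k)) ->
  is_derive t 1 (fun s => energy d (Y s) (xi ^~ s))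
    (energy_rate d (Y t) dY (xi ^~ t) dxi).
Proof.
move=> xi_d.
have pc2_d k : is_derive t 1 (fun s => (pc_rate k + xi k s) * pc (Y s) k ^+ 2)
    (dxi k * pc (Y t) k ^+ 2 +
     (pc_rate k + xi k t) * (2 * (pc (Y t) k * pc dY k))).
  apply: is_derive_mul; last exact: is_derive_sqr.
  by rewrite -[dxi k]add0r; apply: is_deriveD.
have E1 := is_derive_fsum xpredT (fun e => is_derive_weighted_sqr (suscept e) (eta_d e)).
have E2 := is_derive_fsum xpredT (fun j => is_derive_weighted_sqr (inertia j) (omega_d j)).
have E3 := is_derive_fsum xpredT
  (fun g => is_derive_weighted_sqr (tau g / droop g) (xg_d g)).
have E4 := is_derive_fsum xpredT (fun e => is_derive_weighted_sqr (psi_rate e) (psi_d e)).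
have E5 := is_derive_fsum xpredT pc2_d.
have F1 := is_derive_mull ((1 + d) / 2) (is_deriveD E1 E2).
have F2 := is_derive_mull 2^-1 (is_deriveD (is_deriveD E3 E4) E5).
have F := is_deriveD F1 F2.
apply: (is_derive_eq F); rewrite /energy_rate !mulrDr !mulr_sumr.
by congr (_ + _ + (_ + _ + _)); apply: eq_bigr => i _; field;
  rewrite ?gt_eqF ?droop_gt0.
Qed.

End LyapunovDerivative.

(** * Recovering gradients from outflows, and constructing an equilibrium *)

Section Equilibria.
Context {R : realType} {P : network R}.

Lemma sum_by_bus (f : unit_ P -> R) :
  \sum_j \sum_(k : unit_ P | unit_bus k == j) f k = \sum_k f k.
Proof. by rewrite [RHS](partition_big (@unit_bus R P) predT). Qed.

(** Each column of the incidence matrix sums to zero, so it is the Laplacian of some potential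
    [G e]. By symmetry of the Laplacian, pairing the column with [th] is pairing [G e] with the
    weighted outflow of [y]; the potential [th] disappears from the formula. *)
Lemma gradient_recovery (T : finType) (E : {set T * T}) (b : edge E -> R) :
  oriented E -> connected_graph E -> (forall e, 0 < b e) ->
  exists G : edge E -> T -> R, forall (y : edge E -> R) (th : T -> R),
    (forall e, y e = \sum_i incidence R i e * th i) ->
    forall e, y e = \sum_k G e k * \sum_e' incidence R k e' * (b e' * y e').
Proof.
move=> oriE conE b0.
have /boolp.choice[G hG] : forall e : edge E, exists th : T -> R, forall k,
    \sum_e' incidence R k e' * (b e' * \sum_i incidence R i e' * th i) =
    incidence R k e.
  by move=> e; apply: laplacian_solvable => //; exact: sum_incidence1.
exists G => y th yE e; rewrite yE.
transitivity (\sum_i \sum_e' (incidence R i e' * th i)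
    * (b e' * \sum_k incidence R k e' * G e k)).
  apply: eq_bigr => i _; rewrite -hG mulr_suml; apply: eq_bigr => e' _; ring.
rewrite exchange_big/=.
transitivity (\sum_e' \sum_k G e k * (incidence R k e' * (b e' * y e'))).
  apply: eq_bigr => e' _; rewrite -mulr_suml -yE !mulr_sumr.
  by apply: eq_bigr => k _; ring.
by rewrite exchange_big/=; apply: eq_bigr => k _; rewrite mulr_sumr.
Qed.

Lemma sum_outflow (T : finType) (E : {set T * T}) (f : edge E -> R) :
  oriented E -> \sum_k \sum_e incidence R k e * f e = 0.
Proof.
move=> oriE; rewrite exchange_big/=; apply: big1 => e _.
by rewrite -mulr_suml sum_incidence1// mul0r.
Qed.

Lemma outflowE (T : finType) (E : {set T * T}) (f : edge E -> R) k :
  oriented E -> \sum_e incidence R k e * f e =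
  \sum_(e : edge E | (val e).1 == k) f e - \sum_(e : edge E | (val e).2 == k) f e.
Proof.
move=> oriE; rewrite [X in X - _]big_mkcond [X in _ - X]big_mkcond -sumrB/=.
apply: eq_bigr => e _; have := edge_neq oriE e.
rewrite /incidence !(eq_sym k); have [->|_] := eqVneq (val e).1 k.
  by rewrite eq_sym => /negPf ->; rewrite mul1r subr0.
by move=> _; case: eqP => _; rewrite ?mulN1r ?mul0r sub0r ?oppr0.
Qed.

Lemma power_balance (z : state P) (j : bus P) :
  \sum_(g : gen P | gen_bus g == j) mech_power z (pc z) g
  - \sum_(l : load P | load_bus l == j) ctrl_demand z (pc z) l
  - \sum_(k in units_at j) demand k - damping j * omega z j
  - \sum_(e : line P | (val e).1 == j) flow z e
  + \sum_(e : line P | (val e).2 == j) flow z e =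
  - \sum_(k : unit_ P | unit_bus k == j) prosumption z (pc z) k
  - damping j * omega z j - bus_outflow z j.
Proof.
rewrite /bus_outflow (outflowE (fun e => suscept e * eta z e))//; last first.
  exact: lines_oriented.
rewrite (eq_bigl (fun k : unit_ P => unit_bus k == j)); last by move=> k; rewrite inE.
rewrite !big_sumType/= !big_split/= !sumrN big_split/=.
by rewrite /flow; ring.
Qed.

Definition state_sub (z w : state P) : state P :=
  State (fun e => eta z e - eta w e) (fun e => psi z e - psi w e)
    (fun j => omega z j - omega w j) (fun g => xg z g - xg w g)
    (fun k => pc z k - pc w k).

Lemma prosumption_sub (z w : state P) (k : unit_ P) :
  prosumption z (pc z) k - prosumption w (pc w) k = response (state_sub z w) k.
Proof.
by case: k => [g|l]; rewrite /response/= /mech_power /ctrl_demand/=; ring.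
Qed.

Lemma error_dynamicsP (beta : unit_ P -> R) (z dz w : state P)
    (n nd nf xi : unit_ P -> R) :
  closed_loop z dz n -> closed_loop w (state0 P) (fun=> 0) ->
  privacy_values beta z dz n nd nf xi ->
  error_dynamics (state_sub z w) dz xi nf.
Proof.
move=> [etaE omE xE psiE pcE] [etaw omw xw psiw pcw] priv; split.
- move=> e; rewrite (sum_incidence (@lines_oriented R P) e (omega (state_sub z w))).
  by rewrite etaE /=; have := etaw e => /= h; lra.
- move=> j; rewrite omE power_balance.
  have := omw j; rewrite power_balance/= mulr0 => h.
  rewrite -[LHS]subr0 [X in _ - X = _]h /bus_outflow/=.
  under [X in _ = - X - _ - _]eq_bigr do rewrite -prosumption_sub.
  under [X in _ = _ - X]eq_bigr do rewrite !mulrBr.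
  by rewrite !sumrB; ring.
- by move=> g; rewrite xE/=; have := xw g => /= h; lra.
- move=> e; rewrite psiE/=; under [RHS]eq_bigr do rewrite mulrBr.
  by rewrite sumrB -(psiw e)/= mulr0 subr0.
- move=> k; have [nE ndE _ _] := priv k.
  rewrite mulrDl pcE nE ndE -prosumption_sub /link_outflow/=.
  under [X in _ = _ - X + _]eq_bigr do rewrite mulrBr.
  by rewrite sumrB; have := pcw k => /= h; lra.
Qed.

(* The equilibrium is chosen with the same conserved components as [z0]: the
   deviations of [eta] and [psi] from it are gradients, and stay so. *)
Lemma equilibrium_exists (z0 : state P) : exists (w : state P) th ph,
  [/\ closed_loop w (state0 P) (fun=> 0), forall j, omega w j = 0,
      forall e, eta z0 e - eta w e = \sum_j incidence R j e * th j
    & forall e, psi_rate e * (psi z0 e - psi w e) =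
        \sum_k incidence R k e * ph k].
Proof.
(* [mh] is the static gain from [pc] to power at zero frequency. With a common value [c] of [pc],
   the prosumption is [demand k - c * mh k], and [c] is fixed by requiring a zero total, since
   outflows sum to zero. *)
pose mh (k : unit_ P) := match k with inl g => droop g | inr _ => 0 end + gain k.
have mh0 k : 0 < mh k.
  by case: k => [g|l]; rewrite /mh ?add0r ?addr_gt0 ?droop_gt0 ?gain_gt0.
pose c := (\sum_(k : unit_ P) demand k) / (\sum_k mh k).
pose s k := demand k - c * mh k.
have s0 : \sum_k s k = 0.
  rewrite sumrB -mulr_sumr /c; apply/eqP; rewrite subr_eq0.
  (* A zero total gain means that there are no units, in which case the total demand is zero as
     well. *)
  have [e0|n0] := eqVneq (\sum_k mh k) 0; last by rewrite divfK.
  rewrite e0 mulr0; apply/eqP; apply: big1 => k _.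
  have /psumr_eq0P/(_ e0)/(_ k isT) : forall k, true -> 0 <= mh k.
    by move=> k' _; exact: ltW.
  by move=> mk; have := mh0 k; rewrite mk ltxx.
have [ph hph] : exists ph : unit_ P -> R, forall k, \sum_e incidence R k e
    * ((psi_rate e)^-1 * \sum_l incidence R l e * ph l) = link_outflow z0 k - s k.
  apply: laplacian_solvable.
  - exact: links_oriented.
  - exact: links_connected.
  - by move=> e; rewrite invr_gt0 psi_rate_gt0.
  - by rewrite sumrB s0 (sum_outflow _ (@links_oriented R P)) subr0.
have [th hth] : exists th : bus P -> R, forall j, \sum_e incidence R j e
    * (suscept e * \sum_l incidence R l e * th l) =
    bus_outflow z0 j + \sum_(k : unit_ P | unit_bus k == j) s k.
  apply: laplacian_solvable.
  - exact: lines_oriented.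
  - exact: lines_connected.
  - exact: suscept_gt0.
  - rewrite big_split/= (sum_outflow _ (@lines_oriented R P)) add0r.
    by rewrite sum_by_bus.
(* Only gradients are subtracted; they are chosen so that the link outflow of [w] is [s] and its bus
   outflow is minus the sum of [s] at the bus. *)
pose w : state P := State (fun e => eta z0 e - \sum_j incidence R j e * th j)
  (fun e => psi z0 e - (psi_rate e)^-1 * \sum_k incidence R k e * ph k)
  (fun=> 0) (fun g => droop g * c) (fun=> c).
have sE k : prosumption w (pc w) k = s k.
  by case: k => [g|l]; rewrite /s /mh /= /mech_power /ctrl_demand/=; ring.
exists w, th, ph; split => //=.
- split => /=.
  + by move=> e; rewrite subrr.
  + move=> j; rewrite power_balance/= mulr0 /bus_outflow/= (eq_bigr s)//.
    under [X in _ - _ - X]eq_bigr do rewrite 2!mulrBr.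
    by rewrite [X in _ - X]sumrB hth -/(bus_outflow z0 j); ring.
  + by move=> g; ring.
  + move=> e; rewrite -mulr_suml (sum_incidence1 (@links_oriented R P)).
    by rewrite mul0r mulr0.
  + move=> k; rewrite sE mulr0 addr0.
    under eq_bigr do rewrite mulrBr.
    by rewrite sumrB hph -/(link_outflow z0 k); ring.
- by move=> e; rewrite subKr.
- by move=> e; rewrite subKr mulrA mulfV ?mul1r// gt_eqF// psi_rate_gt0.
Qed.

End Equilibria.

(** * Equilibria and convergence *)

Section Convergence.
Context {R : realType} {P : network R}.
Variables beta betahat : unit_ P -> R.
Hypothesis beta_gt0 : forall k, 0 < beta k.
Hypothesis betahat_gt0 : forall k, 0 < betahat k.
Hypothesis lmi : forall k, neg_semidefinite (privacy_lmi beta betahat k).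

(** Constant angles force a common frequency [v]. Summing the bus equations and summing the [pc]
    equations gives two values of the total prosumption, whence [v] times the total damping equals
    the total of [nf], at most [|v|] times the total of [beta]. Since each [beta k] is below its
    damping share, [v] vanishes. *)
Lemma equilibrium_omega (z : state P) : equilibrium beta z -> forall j, omega z j = 0.
Proof.
move=> [n [nd [nf [xi [priv [etaE omE _ _ pcE]]]]]] j.
pose v := omega z j.
have omv i : omega z i = v.
  apply: (connected_constant (@lines_connected R P) _ i j) => e.
  by have := etaE e => /= /eqP; rewrite eq_sym subr_eq0 => /eqP.
have sumS : \sum_(k : unit_ P) prosumption z (pc z) k = - (v * \sum_(i : bus P) damping i).
  have : \sum_i (inertia i * omega (state0 P) i) = 0.
    by apply: big1 => i _; rewrite mulr0.
  under eq_bigr do rewrite omE power_balance omv.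
  rewrite !sumrB sumrN /bus_outflow (sum_outflow _ (@lines_oriented R P)) subr0.
  rewrite sum_by_bus -mulr_suml => h.
  by lra.
have sumN : \sum_(k : unit_ P) prosumption z (pc z) k = - \sum_k nf k.
  have : \sum_(k : unit_ P) pc_rate k * pc (state0 P) k = 0.
    by apply: big1 => k _; rewrite mulr0.
  under eq_bigr do rewrite pcE.
  rewrite big_split/= sumrB (sum_outflow _ (@links_oriented R P)) subr0.
  rewrite [X in _ + X = _](eq_bigr nf); first by move=> h; lra.
  by move=> k _; have [-> -> _ _] := priv k; rewrite mulr0 add0r.
have nfv : `|\sum_k nf k| <= `|v| * \sum_k beta k.
  apply: (le_trans (ler_norm_sum _ _ _)); rewrite mulr_sumr; apply: ler_sum => k _.
  by have [_ _ _] := priv k; rewrite omv mulrC.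
have vD : `|v| * \sum_(i : bus P) damping i <= `|v| * \sum_k beta k.
  apply: le_trans nfv; move: sumN; rewrite sumS => /oppr_inj <-.
  rewrite normrM [X in _ <= _ * X]ger0_norm//.
  by apply: sumr_ge0 => i _; exact/ltW/damping_gt0.
apply/eqP; rewrite -/v -normr_eq0; apply/negPn/negP => v0.
have {}v0 : 0 < `|v| by rewrite lt_def v0 normr_ge0.
move: vD; rewrite ler_pM2l// leNgt => /negP; apply.
have share : \sum_(k : unit_ P) damping_share k <= \sum_(i : bus P) damping i.
  have := @damping_share_sum_le R P (fun=> 1).
  by under eq_bigr do rewrite expr1n mulr1; under [leRHS]eq_bigr do rewrite expr1n mulr1.
case: (pickP (@predT (unit_ P))) => [k0 _|no].
  apply: lt_le_trans share; rewrite (bigD1 k0)//= [ltRHS](bigD1 k0)//=.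
  rewrite ltr_leD ?(beta_lt_damping_share beta_gt0 betahat_gt0 lmi)//.
  by apply: ler_sum => k _; exact/ltW/(beta_lt_damping_share beta_gt0 betahat_gt0 lmi).
(* Without units the noise total is an empty sum, and the damping at [j] alone exceeds it. *)
rewrite [ltLHS]big_pred0//.
rewrite (bigD1 j)//= ltr_pwDl ?damping_gt0//.
by apply: sumr_ge0 => i _; exact/ltW/damping_gt0.
Qed.

Lemma equilibrium_of_closed_loop (w : state P) :
  closed_loop w (state0 P) (fun=> 0) -> equilibrium beta w.
Proof.
move=> cw; exists (fun=> 0), (fun=> 0), (fun=> 0), (fun=> 0); split => // k.
by split => //; rewrite ?addr0 ?oppr0 ?mul0r// normr0 mulr_ge0// ltW.
Qed.

Lemma derivable_is_derive (f : R -> R) (t : R) :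
  derivable f t 1 -> is_derive t 1 f (derive1 f t).
Proof. by move=> /derivableP; rewrite derive1E. Qed.

Lemma is_derive_shift (f : R -> R) (c t : R) :
  derivable f t 1 -> is_derive t 1 (fun s => f s - c) (derive1 f t).
Proof.
move=> /derivable_is_derive fd; rewrite -[derive1 f t]subr0.
exact: is_deriveB.
Qed.

Variables (z : R -> state P) (n nd nf xi : unit_ P -> R -> R).
Hypothesis sol : is_solution z n.
Hypothesis sig : privacy_signals beta betahat z n nd nf xi.

Lemma xi_linear_bound : exists2 a, 0 < a &
  forall k t, 0 <= t -> pc_rate k + xi k t <= a * (1 + t).
Proof.
have [_ priv xi_d] := sig.
have xi0 k t : 0 <= t -> 0 <= xi k t by move=> t0; have [] := priv t t0 k.
pose b k := pc_rate k + xi k 0 + betahat k.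
have b0 k : 0 < b k by rewrite ltr_pwDr ?addr_ge0 ?xi0// ltW// pc_rate_gt0.
have S0 : 0 <= \sum_k b k by apply: sumr_ge0 => k _; exact: ltW.
exists (1 + \sum_k b k); first by rewrite ltr_pwDl.
move=> k t t0; apply: (@le_trans _ _ (b k * (1 + t))); last first.
  rewrite ler_wpM2r ?addr_ge0// (bigD1 k)//= addrCA lerDl addr_ge0//.
  by apply: sumr_ge0 => i _; exact: ltW.
have : xi k t - betahat k * t <= xi k 0 - betahat k * 0.
  apply: (@nonincreasing_from _ (fun s => xi k s - betahat k * s)
    (fun s => derive1 (xi k) s - betahat k * 1)) => // s s0.
    have [xd _] := xi_d k s s0.
    by apply: is_deriveB; exact: derivable_is_derive.
  by rewrite mulr1 subr_le0 ltW//; have [] := xi_d k s s0.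
have := pc_rate_gt0 k; have := xi0 k 0 (lexx _); have := betahat_gt0 k.
rewrite /b => h1 h2 h3 h4.
have : 0 <= (pc_rate k + xi k 0) * t by rewrite mulr_ge0// addr_ge0// ltW.
lra.
Qed.

Section Deviation.
Variable w : state P.
Hypothesis w_eq : closed_loop w (state0 P) (fun=> 0).
Let Y (t : R) := state_sub (z t) w.

Lemma deviation_dynamics t : 0 <= t ->
  error_dynamics (Y t) (velocity z t) (xi ^~ t) (nf ^~ t).
Proof.
move=> t0; have [_ cl] := sol t0; have [_ priv _] := sig.
exact: error_dynamicsP cl w_eq (priv t t0).
Qed.

(** Following a potential of [eta] in time would require integrating [omega]. Instead the linear
    identity of [gradient_recovery] is propagated: its defect [f] vanishes at time zero and has zero
    derivative, because the velocity of [eta] is a gradient at each instant. *)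
Lemma deviation_eta_bound (th : bus P -> R) :
  (forall e, eta (Y 0) e = \sum_j incidence R j e * th j) ->
  exists2 K, 0 < K & forall t, 0 <= t -> sqn (eta (Y t)) <= K * sqn (bus_outflow (Y t)).
Proof.
move=> Y0; have [G hG] := gradient_recovery (@lines_oriented R P)
  (@lines_connected R P) (@suscept_gt0 R P).
have [K K0 hK] := linear_image_bound G.
exists K => // t t0; apply: hK => e.
pose f s := eta (Y s) e - \sum_j G e j * bus_outflow (Y s) j.
have f0 : f 0 = 0 by apply/eqP; rewrite subr_eq0; apply/eqP; exact: hG Y0 e.
suff : f t = f 0 by rewrite f0 => /eqP; rewrite subr_eq0 => /eqP.
apply: constant_from t0 => s s0.
have [[etad _ _ _ _] _] := sol s0; have [etaE _ _ _ _] := deviation_dynamics s0.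
have := hG _ _ etaE e => /eqP; rewrite -subr_eq0 => /eqP <-.
apply: is_deriveB; first exact: is_derive_shift.
apply: is_derive_fsum => j; apply: is_derive_mull; apply: is_derive_bus_outflow => e'.
exact: is_derive_shift.
Qed.

(** Same argument for [psi_rate * psi], the quantity whose velocity is a gradient, with edge weights
    [psi_rate^-1] so that the weighted outflow is again [link_outflow]. *)
Lemma deviation_psi_bound (ph : unit_ P -> R) :
  (forall e, psi_rate e * psi (Y 0) e = \sum_k incidence R k e * ph k) ->
  exists2 K, 0 < K & forall t, 0 <= t -> sqn (psi (Y t)) <= K * sqn (link_outflow (Y t)).
Proof.
have rate_neq0 e : psi_rate (n := P) e != 0 by rewrite gt_eqF// psi_rate_gt0.
have irate_gt0 (e : link P) : 0 < (psi_rate e)^-1 by rewrite invr_gt0 psi_rate_gt0.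
move=> Y0; have [G hG] := gradient_recovery (@links_oriented R P)
  (@links_connected R P) irate_gt0.
have {}hG (y : state P) (ph' : unit_ P -> R) :
    (forall e, psi_rate e * psi y e = \sum_k incidence R k e * ph' k) ->
    forall e, psi_rate e * psi y e = \sum_k G e k * link_outflow y k.
  move=> yE e; have -> := hG _ _ yE e; apply: eq_bigr => k _; congr (_ * _).
  by apply: eq_bigr => e' _; rewrite mulKf.
have [K K0 hK] := linear_image_bound (fun e k => (psi_rate e)^-1 * G e k).
exists K => // t t0; apply: hK => e.
pose f s := psi_rate e * psi (Y s) e - \sum_k G e k * link_outflow (Y s) k.
have f0 : f 0 = 0 by apply/eqP; rewrite subr_eq0; apply/eqP; exact: hG Y0 e.
suff : f t = f 0.
  rewrite f0 => /eqP; rewrite subr_eq0 => /eqP h.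
  apply: (mulfI (rate_neq0 e)); rewrite h mulr_sumr; apply: eq_bigr => k _.
  by rewrite -mulrA mulVKf.
apply: constant_from t0 => s s0.
have [[_ psid _ _ _] _] := sol s0; have [_ _ _ psiE _] := deviation_dynamics s0.
have := hG _ _ psiE e => /eqP; rewrite -subr_eq0 => /eqP <-.
apply: is_deriveB; first by apply: is_derive_mull; exact: is_derive_shift.
apply: is_derive_fsum => k; apply: is_derive_mull; apply: is_derive_link_outflow => e'.
exact: is_derive_shift.
Qed.

End Deviation.

(** The limit is a single equilibrium [w], the one sharing the conserved components of [z 0]. *)
Lemma solution_converges : converges_to_set z (equilibrium beta).
Proof.
have [w [th0 [ph0 [w_eq om0 etaY psiY]]]] := equilibrium_exists (z 0).
have [Ke Ke0 hKe] := deviation_eta_bound w_eq etaY.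
have [Kp Kp0 hKp] := deviation_psi_bound w_eq psiY.
have [a a0 ha] := xi_linear_bound.
have [d [th [c [c' [c0 c'0 hW]]]]] :=
  lyapunov_inequality beta_gt0 lmi a0 (addr_gt0 Ke0 Kp0).
pose Y t := state_sub (z t) w.
pose W t := energy d (Y t) (xi ^~ t) + th * cross (Y t).
pose dW t := energy_rate d (Y t) (velocity z t) (xi ^~ t)
    (fun k => derive1 (xi k) t) + th * cross_rate (Y t) (velocity z t).
have [_ priv xi_d] := sig.
have W_d (t : R) : 0 <= t -> is_derive t 1 W (dW t).
  move=> t0; have [[eta_d psi_d om_d x_d p_d] _] := sol t0.
  apply: is_deriveD.
    apply: is_derive_energy => [e|e|j|g|k|k]; try exact: is_derive_shift.
    by apply: derivable_is_derive; have [] := xi_d k t t0.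
  apply: is_derive_mull.
  by apply: is_derive_cross => [e|e|j|k]; exact: is_derive_shift.
have hWt (t : R) : 0 <= t ->
    c * (sqn (eta (Y t)) + sqn (psi (Y t)) + damped_sqn (Y t)) <= W t /\
    dW t <= - (c' / (1 + t) * W t).
  move=> t0; apply: (hW _ _ _ _ (nf ^~ t)).
  - exact: deviation_dynamics.
  (* As [omega w = 0], the bound of [nf] by the frequency is a bound by its deviation. *)
  - move=> k; have [_ _ _] := priv t t0 k.
    by rewrite /= om0 subr0.
  - by move=> k; apply: ltW; have [] := xi_d k t t0.
  - by move=> k; have [] := priv t t0 k.
  - by rewrite lerDl.
  - by move=> k; exact: ha.
  - by apply: (le_trans (hKe t t0)); rewrite ler_wpM2r ?sqn_ge0// lerDl ltW.
  - by apply: (le_trans (hKp t t0)); rewrite ler_wpM2r ?sqn_ge0// lerDr ltW.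
have W0 (t : R) : 0 <= t -> 0 <= W t.
  move=> /hWt[+ _]; apply: le_trans; apply: mulr_ge0; first exact: ltW.
  by rewrite /damped_sqn !addr_ge0 ?sqn_ge0.
move=> eps eps0; have ceps : 0 < c * eps ^+ 2 by rewrite mulr_gt0 ?exprn_gt0.
have [T T0 hT] := log_decay c'0 W_d W0 (fun t t0 => (hWt t t0).2) ceps.
exists T; split; first exact: num_real.
move=> t Tt; have t0 : 0 <= t by apply: le_trans T0 (ltW Tt).
exists w; first exact: equilibrium_of_closed_loop.
have small : sqn (eta (Y t)) + sqn (psi (Y t)) + damped_sqn (Y t) < eps ^+ 2.
  by rewrite -(ltr_pM2l c0); apply: le_lt_trans (hT t (ltW Tt)); have [] := hWt t t0.
have comp (I : finType) (v : I -> R) i : sqn v < eps ^+ 2 -> `|v i| < eps.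
  move=> /(le_lt_trans (sqr_le_sqn v i)) h.
  by rewrite -(@ltr_pXn2r _ 2) ?nnegrE ?normr_ge0 ?(ltW eps0)// real_normK ?num_real.
move: small; rewrite /damped_sqn sqn_gen_state.
have := sqn_ge0 (eta (Y t)); have := sqn_ge0 (psi (Y t)).
have := sqn_ge0 (omega (Y t)); have := sqn_ge0 (xg (Y t)).
have := sqn_ge0 (pc (Y t)) => p0 x0 o0 s0 e0 small.
split=> i.
- by apply: (comp _ (eta (Y t))); lra.
- by apply: (comp _ (psi (Y t))); lra.
- by apply: (comp _ (omega (Y t))); lra.
- by apply: (comp _ (xg (Y t))); lra.
- by apply: (comp _ (pc (Y t))); lra.
Qed.

End Convergence.

Unset Implicit Arguments.

Theorem theorem2 (R : realType) (P : network R)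
    (beta betahat : unit_ P -> R)
    (beta_gt0 : forall k, 0 < beta k)
    (betahat_gt0 : forall k, 0 < betahat k)
    (hlmi : forall k, neg_semidefinite (privacy_lmi beta betahat k)) :
  (forall (z : R -> state P) (n nd nf xi : unit_ P -> R -> R),
      is_solution z n ->
      privacy_signals beta betahat z n nd nf xi ->
      converges_to_set z (equilibrium beta))
  /\ (forall z : state P, equilibrium beta z -> forall j, omega z j = 0).
Proof.
split; last exact: (equilibrium_omega beta_gt0 betahat_gt0 hlmi).
move=> z n nd nf xi sol sig.
exact: (solution_converges beta_gt0 betahat_gt0 hlmi sol sig).
Qed.
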